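(* Let $n,p\to\infty$ and consider data $\mathbf{X}=\mathbf{S}+\mathbf{N}\in\mathbb{R}^{n\times p}$ with $\mathbf{S}=\sum_{i=1}^k\theta_i\mathbf{u}_i\mathbf{z}_i^\top$, where $\theta_i\ge0$, $\mathbf{u}_i\in\mathbb{R}^n$, $\mathbf{z}_i\in\mathbb{R}^p$ may be deterministic or random and are not necessarily orthogonal, and where the coefficients $\theta_i$ and the number of terms $k$ may change with $n$ and $p$. Suppose that: 1. $\mathbf{N}$ has independent entries with symmetric distributions, i.e., $N_{ij}=_d-N_{ij}$ for all $i,j$; 2. there is a constant $\bar\sigma$ (independent of $n$ and $p$) such that $\|\mathbf{N}\|\to\bar\sigma$ in probability; 3. there is a constant $\varepsilon>0$ such that $\Pr[\sigma_k(\mathbf{X})>\|\mathbf{N}\|+\varepsilon]\to1$. Let $\hat k$ be the output of FlipPA on $\mathbf{X}$ using the upper-edge comparison method with threshold $\tau\in(0,\varepsilon)$. If $$\mathbb{E}\left\{\sum_{i=1}^k\theta_i\|\mathbf{u}_i\|_2\|\mathbf{z}_i\|_2\cdot\left[\frac{\|\mathbf{u}_i\|_\infty/\|\mathbf{u}_i\|_2+\|\mathbf{z}_i\|_\infty/\|\mathbf{z}_i\|_2}{2}\right]\right\}\to0,$$ then FlipPA is consistent, i.e., $\Pr[\hat k=k]\to1$.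
   Context: $\|\cdot\|$ is the operator (spectral) norm, $\sigma_1(\mathbf{X})\ge\sigma_2(\mathbf{X})\ge\cdots$ are the singular values of $\mathbf{X}$, with $\sigma_j=0$ for $j>\min(n,p)$ and $\sigma_0=+\infty$. If $\mathbf{u}_i$ or $\mathbf{z}_i$ is zero, the corresponding summand is interpreted as $0$. FlipPA with upper-edge comparison. Input: $\mathbf{X}\in\mathbb{R}^{n\times p}$, quantile $q\in[0,1]$, number of trials $T\ge1$, threshold $\tau\ge0$ ($q$, $T$, $\tau$ are fixed as $n,p\to\infty$). Let $\mathbf{R}^{(1)},\dots,\mathbf{R}^{(T)}$ be independent random matrices, each uniform on $\{-1,+1\}^{n\times p}$, and independent of $(\mathbf{S},\mathbf{N})$. Let $\tilde\sigma^{(t)}_1=\|\mathbf{R}^{(t)}\circ\mathbf{X}\|$, where $\circ$ is the entrywise product. The output $\hat k$ is the smallest integer $j\ge0$ such that $\sigma_{j+1}(\mathbf{X})\le\text{$q$-quantile of }(\tilde\sigma^{(1)}_1,\dots,\tilde\sigma^{(T)}_1)+\tau$. Sample quantiles. The $q$-quantile of a sample $x_1,\dots,x_T$ is computed by any one (fixed) of the nine definitions enumerated by Hyndman and Fan (1996). With order statistics $x_{(1)}\le\dots\le x_{(T)}$ and the conventions $x_{(j)}=x_{(1)}$ for $j<1$, $x_{(j)}=x_{(T)}$ for $j>T$, it equals $(1-c)x_{(j)}+c\,x_{(j+1)}$ with $j=\lfloor qT+m\rfloor$, $g=qT+m-j$, where: type 1: $m=0$, $c=\mathbf{1}(g>0)$;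 type 2: $m=0$, $c=1$ if $g>0$ and $c=1/2$ if $g=0$; type 3: $m=-1/2$, $c=0$ if $g=0$ and $j$ is even, $c=1$ otherwise; types 4–9: $c=g$ and $m=0,\ 1/2,\ q,\ 1-q,\ (q+1)/3,\ q/4+3/8$ respectively. *)

(* Defs.v *)
From mathcomp Require Import all_boot all_order all_algebra.
From mathcomp Require Import all_classical all_reals all_analysis.
From mathcomp Require Import lra.
From mathcomp Require complex.

Set Implicit Arguments.
Unset Strict Implicit.
Unset Printing Implicit Defensive.

Import Order.TTheory GRing.Theory Num.Theory.
Import numFieldNormedType.Exports.

Local Open Scope classical_set_scope.
Local Open Scope ring_scope.

Section LinearAlgebra.
Context {R : realType}.

Definition norm2 (n : nat) (x : 'cV[R]_n) : R :=
  Num.sqrt (\sum_(i < n) x i 0 ^+ 2).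

(* For x : 'cV[R]_n, the library norm `|x| is the maximum of the absolute
   values of the entries (lemma mx_normrE), that is, the sup norm of x. *)
Definition norm_sup (n : nat) (x : 'cV[R]_n) : R := `|x|.

Definition opnorm (n p : nat) (X : 'M[R]_(n, p)) : R :=
  sup [set norm2 (X *m x) | x in [set x : 'cV[R]_p | norm2 x <= 1]].

Definition hadamard (n p : nat) (A B : 'M[R]_(n, p)) : 'M[R]_(n, p) :=
  map2_mx *%R A B.

(* The list of singular values has length p; when n < p its last p - n
   entries are zero. *)
Definition is_singular_values (n p : nat) (X : 'M[R]_(n, p)) (s : seq R) :=
  [/\ sorted >=%R s, all (>= 0) s &
      char_poly (X^T *m X) = \prod_(x <- s) ('X - (x ^+ 2)%:P)].

Definition singular_values (n p : nat) (X : 'M[R]_(n, p)) : seq R :=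
  xget [::] [set s | is_singular_values X s].

Definition sigma (n p : nat) (X : 'M[R]_(n, p)) (j : nat) : \bar R :=
  if j is i.+1 then ((singular_values X)`_i)%:E else +oo%E.

End LinearAlgebra.

Section Existence.
Import complex.
Local Open Scope sesquilinear_scope.

Lemma char_poly_similar (F : comUnitRingType) p (U D : 'M[F]_p) :
  U \in unitmx -> char_poly (invmx U *m D *m U) = char_poly D.
Proof.
move=> Uu; have e : map_mx polyC (invmx U) *m map_mx polyC U = 1%:M.
  by rewrite -map_mxM mulVmx// map_mx1.
rewrite /char_poly.
suff -> : char_poly_mx (invmx U *m D *m U) =
    map_mx polyC (invmx U) *m char_poly_mx D *m map_mx polyC U.
  by rewrite !det_mulmx mulrAC -det_mulmx e det1 mul1r.
rewrite /char_poly_mx mulmxBr mulmxBl !map_mxM; congr (_ - _).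
by rewrite scalar_mxC -mulmxA e mulmx1.
Qed.

Lemma singular_valuesP (R : realType) (n p : nat) (X : 'M[R]_(n, p)) :
  is_singular_values X (singular_values X).
Proof.
suff: exists s, is_singular_values X s.
  by case=> s Hs; rewrite /singular_values; case: xgetP => [t -> //|/(_ s)].
pose C : numClosedFieldType := complex R.
pose f : {rmorphism R -> C} := real_complex R.
pose A : 'M[C]_p := map_mx f (X^T *m X).
have conjf (r : R) : (f r)^* = f r by apply/CrealP; rewrite complex_real.
have conjfM a b (M : 'M[R]_(a, b)) : map_mx Num.conj (map_mx f M) = map_mx f M.
  by apply/matrixP => i j; rewrite !mxE conjf.
have Aherm : A \is hermsymmx.
  apply/is_hermitianmxP; rewrite expr0 scale1r.
  by rewrite -map_trmx /A conjfM map_trmx trmx_mul trmxK.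
have /hermitian_normalmx /orthomx_spectralP := Aherm.
set U := spectralmx A; set d := spectral_diag A => A_eq.
have Uu : U \in unitmx := spectral_unit A.
have UV : invmx U = U^t* by apply: invmx_unitary; apply: spectral_unitarymx.
pose Y := map_mx f X *m U^t*.
have dE : diag_mx d = Y^t* *m Y.
  have -> : diag_mx d = U *m A *m invmx U by rewrite A_eq !mulmxA mulmxV// mul1mx mulmxK.
  rewrite UV /A /Y trmx_mul map_mxM map_mxM !mulmxA; congr (_ *m _ *m _ *m _).
    by rewrite map_trmx trmxK -map_mx_comp map_mx_id// => x /=; rewrite conjCK.
  by rewrite -!map_trmx conjfM.
have d_ge0 j : 0 <= d 0 j.
  have /matrixP/(_ j j) := dE; rewrite !mxE eqxx mulr1n => ->.
  by apply: sumr_ge0 => i _; rewrite 2!mxE mulrC mul_conjC_ge0.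
pose r j : R := complex.Re (d 0 j).
have fr j : f (r j) = d 0 j.
  by rewrite /r /f /= RRe_real// ger0_real.
have r_ge0 j : 0 <= r j by rewrite -(@lecR R) -/(f (r j)) fr.
exists (sort >=%R [seq Num.sqrt (r j) | j : 'I_p]); split.
- by apply: sort_sorted => x y; exact: le_total.
- by rewrite all_sort; apply/allP => _ /mapP[j _ ->]; exact: sqrtr_ge0.
rewrite (perm_big _ (permEl (perm_sort _ _))) big_image/=.
apply: (map_poly_inj f); rewrite map_char_poly -/A A_eq char_poly_similar//.
rewrite char_poly_trig ?diag_mx_is_trig// rmorph_prod; apply: eq_bigr => j _.
rewrite rmorphB/= map_polyX map_polyC/= sqr_sqrtr//.
by rewrite -[(r j)%:C%C]/(f (r j)) fr mxE eqxx mulr1n.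
Qed.
End Existence.

Inductive quantile_type : Type :=
  HF1 | HF2 | HF3 | HF4 | HF5 | HF6 | HF7 | HF8 | HF9.

Section SampleQuantile.
Context {R : realType}.

(* x_(j) for an integer j, clamped to the range 1, ..., T. *)
Definition order_stat (T : nat) (x : 'I_T -> R) (j : int) : R :=
  (sort <=%R [seq x t | t : 'I_T])`_(minn `|Num.max j 1|%N T).-1.

Definition quantile_shift (a : quantile_type) (q : R) : R :=
  match a with
  | HF1 => 0 | HF2 => 0 | HF3 => - 2^-1
  | HF4 => 0 | HF5 => 2^-1 | HF6 => q
  | HF7 => 1 - q | HF8 => (q + 1) / 3 | HF9 => q / 4 + 3 / 8
  end.

Definition quantile_weight (a : quantile_type) (j : int) (g : R) : R :=
  match a with
  | HF1 => if 0 < g then 1 else 0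
  | HF2 => if 0 < g then 1 else 2^-1
  | HF3 => if (g == 0) && ~~ odd `|j|%N then 0 else 1
  | HF4 | HF5 | HF6 | HF7 | HF8 | HF9 => g
  end.

Definition sample_quantile (a : quantile_type) (q : R) (T : nat)
    (x : 'I_T -> R) : R :=
  let y := q * T%:R + quantile_shift a q in
  let j := Num.floor y in
  let c := quantile_weight a j (y - j%:~R) in
  (1 - c) * order_stat x j + c * order_stat x (j + 1).

Definition flippa_threshold (a : quantile_type) (q tau : R) (T n p : nat)
    (X : 'M[R]_(n, p)) (Rs : 'I_T -> 'M[R]_(n, p)) : R :=
  sample_quantile a q (fun t => opnorm (hadamard (Rs t) X)) + tau.

Definition flippa_stop (a : quantile_type) (q tau : R) (T n p : nat)
    (X : 'M[R]_(n, p)) (Rs : 'I_T -> 'M[R]_(n, p)) : set nat :=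
  [set j | (sigma X j.+1 <= (flippa_threshold a q tau X Rs)%:E)%E].

Definition flippa (a : quantile_type) (q tau : R) (T n p : nat)
    (X : 'M[R]_(n, p)) (Rs : 'I_T -> 'M[R]_(n, p)) : nat :=
  xget 0%N [set j | flippa_stop a q tau X Rs j /\
    forall i, flippa_stop a q tau X Rs i -> (j <= i)%N].

Lemma opnorm_ge0 (n p : nat) (X : 'M[R]_(n, p)) : 0 <= opnorm X.
Proof.
rewrite /opnorm; set A := (X in sup X).
have [supA|/sup_out->//] := pselect (has_sup A).
have /(ub_le_sup supA.2) : A (norm2 (X *m 0)).
  by exists 0 => //=; rewrite /norm2 big1 ?sqrtr0 ?ler01// => i _; rewrite mxE expr0n.
by apply: le_trans; exact: sqrtr_ge0.
Qed.

Lemma sample_quantile_ge0 (a : quantile_type) (q : R) (T : nat)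
  (x : 'I_T -> R) : (forall t, 0 <= x t) -> 0 <= sample_quantile a q x.
Proof.
move=> x0; have o0 j : 0 <= order_stat x j.
  rewrite /order_stat; set s := sort _ _; set i := _.-1.
  have [lt_is|/(nth_default 0)->//] := ltnP i (size s).
  have : s`_i \in s by exact: mem_nth.
  by rewrite mem_sort => /mapP[t _ ->].
rewrite /sample_quantile; move: (q * _ + _) => y; cbv zeta.
set j := Num.floor y.
have g0 : 0 <= y - j%:~R by rewrite subr_ge0 Num.Theory.floor_le.
have g1 : y - j%:~R <= 1.
  have := Num.Theory.floorD1_gt y; rewrite intrD -/j => y1.
  by rewrite lerBlDl ltW.
set c := quantile_weight _ _ _; have /andP[c0 c1] : 0 <= c <= 1.
  by case: a {o0} @c => /=; try case: ifP => _; lra.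
by rewrite addr_ge0// mulr_ge0// subr_ge0.
Qed.

Lemma flippaP (a : quantile_type) (q tau : R) (T n p : nat)
    (X : 'M[R]_(n, p)) (Rs : 'I_T -> 'M[R]_(n, p)) : 0 <= tau ->
  flippa_stop a q tau X Rs (flippa a q tau X Rs) /\
  forall i, flippa_stop a q tau X Rs i -> (flippa a q tau X Rs <= i)%N.
Proof.
move=> tau0; suff [k Hk] : exists k, flippa_stop a q tau X Rs k /\
    forall i, flippa_stop a q tau X Rs i -> (k <= i)%N.
  by rewrite /flippa; case: xgetP => [j -> //|/(_ k)].
have ex : exists j, `[< flippa_stop a q tau X Rs j >].
  exists (size (singular_values X)); apply/asboolP.
  rewrite /flippa_stop/= nth_default// lee_fin addr_ge0//.
  by apply: sample_quantile_ge0 => t; exact: opnorm_ge0.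
exists (ex_minn ex); case: ex_minnP => k /asboolP kP kmin; split=> // i iP.
by apply: kmin; apply/asboolP.
Qed.

End SampleQuantile.

Section Probability.
Context {d : measure_display} {Omega : measurableType d} {R : realType}.
Local Open Scope ereal_scope.

Definition random_mx (n p : nat) (X : Omega -> 'M[R]_(n, p)) : Prop :=
  forall i j, measurable_fun [set: Omega] (fun w => X w i j).

Definition sigma_of_mx (n p : nat) (X : Omega -> 'M[R]_(n, p)) :
    set (set Omega) :=
  <<s \bigcup_(ij in [set: 'I_n * 'I_p])
        preimage_set_system [set: Omega] (fun w => X w ij.1 ij.2) measurable >>.

Definition independent_families (P : probability Omega R) (I : finType)
    (F : I -> set (set Omega)) : Prop :=
  forall (J : {set I}) (A : I -> set Omega), (forall i, i \in J -> F i (A i)) ->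
    P (\bigcap_(i in [set` J]) A i) = \prod_(i in J) P (A i).

Definition independent_entries (P : probability Omega R) (n p : nat)
    (X : Omega -> 'M[R]_(n, p)) : Prop :=
  independent_families P (fun ij : 'I_n * 'I_p =>
    preimage_set_system [set: Omega] (fun w => X w ij.1 ij.2) measurable).

Definition symmetric_entries (P : probability Omega R) (n p : nat)
    (X : Omega -> 'M[R]_(n, p)) : Prop :=
  forall i j (B : set R), measurable B ->
    pushforward P (fun w => X w i j) B =
    pushforward P (fun w => (- X w i j)%R) B.

Definition uniform_signs (P : probability Omega R) (n p : nat)
    (X : Omega -> 'M[R]_(n, p)) : Prop :=
  forall E : 'M[bool]_(n, p),
    P [set w | X w = (\matrix_(i, j) (-1) ^+ E i j)%R] =
    ((2 ^+ (n * p))^-1)%:E.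

(* Mutual independence of Rs_1, ..., Rs_T and of the pair (S, N), which is
   encoded as the block matrix [S N]. *)
Definition independent_signs (P : probability Omega R) (T n p : nat)
    (S N : Omega -> 'M[R]_(n, p)) (Rs : 'I_T -> Omega -> 'M[R]_(n, p)) : Prop :=
  independent_families P (fun o : option 'I_T =>
    if o is Some t then sigma_of_mx (Rs t)
    else sigma_of_mx (fun w => row_mx (S w) (N w))).

End Probability.

Section Asymptotics.
Context {R : realType} {d : nat -> measure_display}
  {Omega : forall m, measurableType (d m)}.

Definition cvg_in_probability (P : forall m, probability (Omega m) R)
    (Y : forall m, Omega m -> R) (l : R) : Prop :=
  forall delta : R, 0 < delta ->
    (P m [set w | (delta < `|Y m w - l|)%R] @[m --> \oo] --> 0)%E.

End Asymptotics.

(* When u = 0 or z = 0 the factor norm2 u * norm2 z makes this 0, the quotient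
   by 0 being an ordinary real number. *)
Definition delocalization_term {R : realType} (n p : nat) (theta : R)
    (u : 'cV[R]_n) (z : 'cV[R]_p) : R :=
  theta * norm2 u * norm2 z *
  ((norm_sup u / norm2 u + norm_sup z / norm2 z) / 2).

(* Main.v *)
(* Write R o X = R o S + R o N for each sign matrix R. Since N has independent
   symmetric entries, R o N has the law of N, so that its norm tends to sigmabar.
   The norm of R o S tends to 0 in mean because R o (u z^T) = diag(u) R diag(z)
   has expected norm at most a constant times |u|_2 |z|_oo + |z|_2 |u|_oo. Hence
   every trial, and with it every sample quantile, is close to sigmabar, and the
   threshold separates sigma_{k+1}(X) <= |N| (S has rank at most k) from
   sigma_k(X) > |N| + eps. *)
Require Import Defs.
From HB Require Import structures.
From mathcomp Require Import all_boot all_order all_algebra.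
From mathcomp Require Import all_classical all_reals all_analysis.
From mathcomp Require Import measurable_realfun.
From mathcomp Require Import ring lra.
From mathcomp Require complex.

Set Implicit Arguments.
Unset Strict Implicit.
Unset Printing Implicit Defensive.

Import Order.TTheory GRing.Theory Num.Theory.
Import numFieldNormedType.Exports.

Local Open Scope classical_set_scope.
Local Open Scope ring_scope.

(** * Euclidean and operator norms *)

Section OperatorNorm.
Context {R : realType}.
Implicit Types n p : nat.

(** The delocalization condition has no logarithmic factor to spare, so the expected norm of diag(u)
    R diag(z) must be bounded with a constant free of the dimensions; the sqrt(log) of matrix
    concentration inequalities would be too much. A Gaussian comparison of Chevet type would do. The
    proof uses a variational argument instead: the unit vectors y and x of the bilinear form are
    replaced by random vectors having them as means, at the price of a relative entropy. These
    vectors are rescaled sums of signs, so that every expectation involved is a finite sum. S and N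
    may be dependent and the u_i, z_i random. Each trial is therefore split according to the value
    of its sign matrix, after which only events of (S, N) with a fixed sign pattern remain.
    Measurability is a separate obstacle, because singular values are defined by a choice of
    polynomial roots and quantiles by sorting. Both are Lipschitz in their entries, and this alone
    yields measurability. *)

Lemma cauchy_schwarz_sum (I : finType) (a b : I -> R) :
  (\sum_i a i * b i) ^+ 2 <= (\sum_i a i ^+ 2) * (\sum_i b i ^+ 2).
Proof.
(* Lagrange's identity: the defect in Cauchy-Schwarz is half a sum of squares. *)
suff -> : (\sum_i a i ^+ 2) * (\sum_i b i ^+ 2) = (\sum_i a i * b i) ^+ 2 +
    (\sum_i \sum_j (a i * b j - a j * b i) ^+ 2) / 2.
  by rewrite lerDl divr_ge0// sumr_ge0// => i _; rewrite sumr_ge0// => j _; rewrite sqr_ge0.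
have -> : \sum_i \sum_j (a i * b j - a j * b i) ^+ 2 =
    \sum_i \sum_j (a i ^+ 2 * b j ^+ 2) + \sum_i \sum_j (b i ^+ 2 * a j ^+ 2)
    - 2 * \sum_i \sum_j ((a i * b i) * (a j * b j)).
  rewrite mulr_sumr -sumrN -!big_split/=; apply: eq_bigr => i _.
  by rewrite mulr_sumr -sumrN -!big_split/=; apply: eq_bigr => j _; ring.
rewrite -!big_distrlr/= -expr2; set A := \sum_i a i ^+ 2; set B := \sum_i b i ^+ 2; lra.
Qed.

Lemma norm2_ge0 n (x : 'cV[R]_n) : 0 <= norm2 x.
Proof. exact: sqrtr_ge0. Qed.

Lemma sqr_norm2 n (x : 'cV[R]_n) : norm2 x ^+ 2 = \sum_(i < n) x i 0 ^+ 2.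
Proof. by rewrite sqr_sqrtr// sumr_ge0// => i _; rewrite sqr_ge0. Qed.

Lemma dot_le_norm2 n (x y : 'cV[R]_n) :
  \sum_(i < n) x i 0 * y i 0 <= norm2 x * norm2 y.
Proof.
rewrite (le_trans (ler_norm _))// -(@ler_pXn2r _ 2)// ?nnegrE ?mulr_ge0 ?norm2_ge0//.
rewrite real_normK ?num_real// exprMn !sqr_norm2; exact: cauchy_schwarz_sum.
Qed.

Lemma norm20 n : norm2 (0 : 'cV[R]_n) = 0.
Proof. by rewrite /norm2 big1 ?sqrtr0// => i _; rewrite mxE expr0n. Qed.

Lemma norm2_eq0 n (x : 'cV[R]_n) : norm2 x = 0 -> x = 0.
Proof.
move=> x0; apply/matrixP => i j; rewrite ord1 mxE; apply/eqP.
have /eqP := sqr_norm2 x; rewrite x0 expr0n/= eq_sym psumr_eq0.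
  by move/allP/(_ i); rewrite mem_index_enum => /(_ isT); rewrite sqrf_eq0.
by move=> k _; rewrite sqr_ge0.
Qed.

Lemma norm2_triangle n (x y : 'cV[R]_n) : norm2 (x + y) <= norm2 x + norm2 y.
Proof.
rewrite -(@ler_pXn2r _ 2)// ?nnegrE ?addr_ge0 ?norm2_ge0//.
have -> : norm2 (x + y) ^+ 2 =
    norm2 x ^+ 2 + norm2 y ^+ 2 + 2 * \sum_(i < n) x i 0 * y i 0.
  rewrite !sqr_norm2 mulr_sumr -!big_split/=; apply: eq_bigr => i _.
  by rewrite mxE; ring.
have := dot_le_norm2 x y; rewrite sqrrD mulr2n; lra.
Qed.

Lemma norm2Z n (a : R) (x : 'cV[R]_n) : norm2 (a *: x) = `|a| * norm2 x.
Proof.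
rewrite /norm2 -sqrtr_sqr -sqrtrM ?sqr_ge0// mulr_sumr; congr Num.sqrt.
by apply: eq_bigr => i _; rewrite mxE exprMn.
Qed.

Lemma norm2_le_sum n (x : 'cV[R]_n) : norm2 x <= \sum_(i < n) `|x i 0|.
Proof.
rewrite -(@ler_pXn2r _ 2)// ?nnegrE ?sumr_ge0 ?norm2_ge0//.
rewrite sqr_norm2 expr2 big_distrlr/=; apply: ler_sum => i _.
rewrite (bigD1 i)//= -expr2 real_normK ?num_real// lerDl.
by apply: sumr_ge0 => j _; rewrite mulr_ge0.
Qed.

Lemma entry_le_norm2 n (x : 'cV[R]_n) i : `|x i 0| <= norm2 x.
Proof.
rewrite -(@ler_pXn2r _ 2)// ?nnegrE ?norm2_ge0//.
rewrite sqr_norm2 (bigD1 i)//= real_normK ?num_real// lerDl.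
by apply: sumr_ge0 => j _; rewrite sqr_ge0.
Qed.

Lemma norm2_mulmx_entries n p (X : 'M[R]_(n, p)) (e : R) (x : 'cV[R]_p) :
  (forall i j, `|X i j| <= e) -> norm2 (X *m x) <= n%:R * p%:R * e * norm2 x.
Proof.
move=> Xe; rewrite (le_trans (norm2_le_sum _))//.
have -> : n%:R * p%:R * e * norm2 x = \sum_(i < n) \sum_(j < p) (e * norm2 x).
  by rewrite !sumr_const !card_ord -mulrnA -(mulr_natl (e * _)) natrM [p%:R * _]mulrC -!mulrA.
apply: ler_sum => i _; rewrite mxE (le_trans (ler_norm_sum _ _ _))//.
by apply: ler_sum => j _; rewrite normrM ler_pM// entry_le_norm2.
Qed.

(** The supremum of an unbounded set is the default value 0, so no upper bound on norm2 (X *m x) can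
    be read off from [opnorm] without this. *)
Lemma opnorm_has_sup n p (X : 'M[R]_(n, p)) :
  has_sup [set norm2 (X *m x) | x in [set x : 'cV[R]_p | norm2 x <= 1]].
Proof.
split; first by exists (norm2 (X *m 0)), 0 => //=; rewrite norm20.
have [e e0 Xe] : exists2 e : R, 0 <= e & forall i j, `|X i j| <= e.
  exists (\sum_i \sum_j `|X i j|) => [|i j].
    by apply: sumr_ge0 => i _; exact: sumr_ge0.
  rewrite (bigD1 i)//= (bigD1 j)//= -addrA lerDl addr_ge0 ?sumr_ge0// => k _.
  exact: sumr_ge0.
exists (n%:R * p%:R * e) => _ [x /= x1 <-].
by rewrite (le_trans (norm2_mulmx_entries x Xe))// ler_piMr// !mulr_ge0.
Qed.

Lemma le_opnorm n p (X : 'M[R]_(n, p)) (x : 'cV[R]_p) :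
  norm2 (X *m x) <= opnorm X * norm2 x.
Proof.
have [x0|x_neq0] := eqVneq (norm2 x) 0.
  by rewrite (norm2_eq0 x0) mulmx0 !norm20 mulr0.
have x_gt0 : 0 < norm2 x by rewrite lt_neqAle eq_sym x_neq0 norm2_ge0.
rewrite -ler_pdivrMr//.
have -> : norm2 (X *m x) / norm2 x = norm2 (X *m ((norm2 x)^-1 *: x)).
  by rewrite -scalemxAr norm2Z ger0_norm ?invr_ge0 ?norm2_ge0// mulrC.
apply: (ub_le_sup (opnorm_has_sup X).2); exists ((norm2 x)^-1 *: x) => //=.
by rewrite norm2Z ger0_norm ?invr_ge0 ?norm2_ge0// mulVf.
Qed.

(** For fixed x the best y is X x normalised. The entropy argument needs this form, in which y and x
    are moved independently. *)
Lemma opnorm_le_bilinear n p (X : 'M[R]_(n, p)) (c : R) : 0 <= c ->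
  (forall (y : 'cV[R]_n) (x : 'cV[R]_p), norm2 y <= 1 -> norm2 x <= 1 ->
     \sum_(i < n) \sum_(j < p) y i 0 * X i j * x j 0 <= c) ->
  opnorm X <= c.
Proof.
move=> c0 Xc; apply: ge_sup; first exact: (opnorm_has_sup X).1.
move=> _ [x /= x1 <-]; set v := X *m x.
have [->//|v_neq0] := eqVneq (norm2 v) 0.
have := Xc ((norm2 v)^-1 *: v) x; rewrite norm2Z ger0_norm ?invr_ge0 ?norm2_ge0//.
rewrite mulVf// => /(_ (lexx _) x1); apply: le_trans.
have {1}-> : norm2 v = (norm2 v)^-1 * norm2 v ^+ 2 by rewrite expr2 mulKf.
rewrite sqr_norm2 mulr_sumr; apply: ler_sum => i _.
have vE : v i 0 = \sum_j X i j * x j 0 by rewrite /v mxE.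
rewrite expr2 mulrA [X in _ * X <= _]vE mulr_sumr; apply: ler_sum => j _.
by rewrite [X in _ <= X * _ * _]mxE mulrA.
Qed.

Lemma opnorm_le n p (X : 'M[R]_(n, p)) (c : R) : 0 <= c ->
  (forall x : 'cV[R]_p, norm2 (X *m x) <= c * norm2 x) -> opnorm X <= c.
Proof.
move=> c0 Xc; apply: ge_sup; first exact: (opnorm_has_sup X).1.
by move=> _ [x /= x1 <-]; rewrite (le_trans (Xc x))// ler_piMr.
Qed.

Lemma opnormD n p (X Y : 'M[R]_(n, p)) : opnorm (X + Y) <= opnorm X + opnorm Y.
Proof.
apply: opnorm_le => [|x]; first by rewrite addr_ge0 ?opnorm_ge0.
rewrite mulmxDl (le_trans (norm2_triangle _ _))// mulrDl.
by rewrite lerD ?le_opnorm.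
Qed.

Lemma opnormZ_le n p (a : R) (X : 'M[R]_(n, p)) :
  opnorm (a *: X) <= `|a| * opnorm X.
Proof.
apply: opnorm_le => [|x]; first by rewrite mulr_ge0 ?opnorm_ge0.
by rewrite -scalemxAl norm2Z -mulrA ler_wpM2l ?le_opnorm.
Qed.

Lemma opnorm0 n p : opnorm (0 : 'M[R]_(n, p)) = 0.
Proof.
apply/eqP; rewrite eq_le opnorm_ge0 andbT opnorm_le// => x.
by rewrite mul0mx norm20 mul0r.
Qed.

Lemma opnorm_sum n p (I : Type) (r : seq I) (F : I -> 'M[R]_(n, p)) :
  opnorm (\sum_(i <- r) F i) <= \sum_(i <- r) opnorm (F i).
Proof.
elim/big_rec2: _ => [|i y Y _ IH]; first by rewrite opnorm0.
by rewrite (le_trans (opnormD _ _))// lerD2l.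
Qed.

Lemma opnorm_dist n p (X Y : 'M[R]_(n, p)) :
  `|opnorm X - opnorm Y| <= opnorm (X - Y).
Proof.
have := opnormD (X - Y) Y; rewrite subrK => h1.
have := opnormD (Y - X) X; rewrite subrK => h2.
have := opnormZ_le (-1) (X - Y); rewrite scaleN1r opprB normrN1 mul1r => h3.
by rewrite ler_norml; apply/andP; split; lra.
Qed.

Lemma opnorm_entries n p (X : 'M[R]_(n, p)) (e : R) : 0 <= e ->
  (forall i j, `|X i j| <= e) -> opnorm X <= n%:R * p%:R * e.
Proof.
by move=> e0 Xe; apply: opnorm_le => [|x]; rewrite ?mulr_ge0 ?norm2_mulmx_entries.
Qed.

End OperatorNorm.

(** * Singular values *)

Section SingularValues.
Import complex.
Local Open Scope sesquilinear_scope.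
Context {R : realType}.
Implicit Types n p k : nat.
Let C : numClosedFieldType := complex R.
Let f : {rmorphism R -> C} := real_complex R.

(** Stacking real and imaginary parts lets the triangle inequality and the bounds by [opnorm] carry
    over from real vectors. *)
Definition cnorm n (v : 'cV[C]_n) : R :=
  norm2 (col_mx (map_mx (@complex.Re R) v) (map_mx (@complex.Im R) v)).

Definition sqnorm (x : C) : R := complex.Re x ^+ 2 + complex.Im x ^+ 2.

Lemma sqnorm_ge0 x : 0 <= sqnorm x.
Proof. by rewrite addr_ge0 ?sqr_ge0. Qed.

Lemma sqnorm_eq0 x : sqnorm x = 0 -> x = 0.
Proof.
case: x => a b; rewrite /sqnorm/= => /eqP.
by rewrite paddr_eq0 ?sqr_ge0// !sqrf_eq0 => /andP[/eqP-> /eqP->].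
Qed.

Lemma sqnormE (x : C) : f (sqnorm x) = x^* * x.
Proof. by rewrite mulrC -normCK -add_Re2_Im2. Qed.

Lemma sqr_cnorm n (v : 'cV[C]_n) : cnorm v ^+ 2 = \sum_i sqnorm (v i 0).
Proof.
rewrite sqr_norm2 big_split_ord/= -big_split/=; apply: eq_bigr => i _.
by rewrite col_mxEu col_mxEd !mxE.
Qed.

Lemma sqr_cnormE n (v : 'cV[C]_n) : f (cnorm v ^+ 2) = (v^t* *m v) 0 0.
Proof.
rewrite sqr_cnorm rmorph_sum mxE; apply: eq_bigr => i _.
by rewrite [LHS]sqnormE !mxE.
Qed.

Lemma cnorm_ge0 n (v : 'cV[C]_n) : 0 <= cnorm v.
Proof. exact: norm2_ge0. Qed.

Lemma cnorm_triangle n (v w : 'cV[C]_n) : cnorm (v + w) <= cnorm v + cnorm w.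
Proof.
rewrite (le_trans _ (norm2_triangle _ _))// add_col_mx /cnorm.
suff [-> ->] : map_mx (@complex.Re R) (v + w) =
    map_mx (@complex.Re R) v + map_mx (@complex.Re R) w /\
    map_mx (@complex.Im R) (v + w) =
    map_mx (@complex.Im R) v + map_mx (@complex.Im R) w by [].
by split; apply/matrixP => i j; rewrite !mxE; case: (v i j) (w i j) => ? ? [].
Qed.

Lemma cnorm_mulmx_le n p (X : 'M[R]_(n, p)) (v : 'cV[C]_p) :
  cnorm (map_mx f X *m v) <= opnorm X * cnorm v.
Proof.
have ReM (a : R) (z : C) : complex.Re (f a * z) = a * complex.Re z.
  by case: z => ? ? /=; ring.
have ImM (a : R) (z : C) : complex.Im (f a * z) = a * complex.Im z.
  by case: z => ? ? /=; ring.
have ReD : {morph (@complex.Re R) : x y / x + y} by move=> [? ?] [].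
have ImD : {morph (@complex.Im R) : x y / x + y} by move=> [? ?] [].
have ReX : map_mx (@complex.Re R) (map_mx f X *m v) = X *m map_mx (@complex.Re R) v.
  apply/matrixP => i j; rewrite !mxE (big_morph _ ReD erefl).
  by apply: eq_bigr => l _; rewrite !mxE ReM.
have ImX : map_mx (@complex.Im R) (map_mx f X *m v) = X *m map_mx (@complex.Im R) v.
  apply/matrixP => i j; rewrite !mxE (big_morph _ ImD erefl).
  by apply: eq_bigr => l _; rewrite !mxE ImM.
have sqE a (x y : 'cV[R]_a) : norm2 (col_mx x y) ^+ 2 = norm2 x ^+ 2 + norm2 y ^+ 2.
  rewrite !sqr_norm2 big_split_ord/=; congr (_ + _); apply: eq_bigr => i _.
    by rewrite col_mxEu.
  by rewrite col_mxEd.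
rewrite -(@ler_pXn2r _ 2)// ?nnegrE ?mulr_ge0 ?cnorm_ge0 ?opnorm_ge0//.
rewrite /cnorm ReX ImX exprMn !sqE mulrDr -!exprMn lerD//.
  by rewrite ler_pXn2r// ?nnegrE ?mulr_ge0 ?norm2_ge0 ?opnorm_ge0// le_opnorm.
by rewrite ler_pXn2r// ?nnegrE ?mulr_ge0 ?norm2_ge0 ?opnorm_ge0// le_opnorm.
Qed.

(** Turns an index into a count, which is invariant under permutation. With 0 <= c it also holds
    beyond the end of the list, where the default entry 0 is not above c. *)
Lemma sorted_gt_nth (s : seq R) (c : R) k : 0 <= c -> sorted >=%R s ->
  (c < s`_k) = (k < count (> c) s)%N.
Proof.
move=> c0; elim: s k => [|x s IH] [|k] //= xs.
- by rewrite ltNge c0.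
- by rewrite ltNge c0.
- have [//|xc] := ltP c x; rewrite add0n; apply/esym/negbTE.
  rewrite -leqNgt leqn0 -leqn0 leqNgt -has_count; apply/hasPn => y ys /=.
  rewrite -leNgt (le_trans _ xc)//.
  have /allP/(_ _ ys) := order_path_min (rev_trans le_trans) xs; exact.
- rewrite IH ?(path_sorted xs)//; have [cx|xc] := ltP c x; first by rewrite add1n.
  rewrite add0n; suff -> : count (> c) s = 0%N by rewrite !ltn0.
  apply/eqP; rewrite -leqn0 leqNgt -has_count; apply/hasPn => y ys /=.
  rewrite -leNgt (le_trans _ xc)//.
  have /allP/(_ _ ys) := order_path_min (rev_trans le_trans) xs; exact.
Qed.

(** Spectral theorem for X^T X over the complex numbers. The eigenvalues [r] match the squared
    singular values only up to a permutation, hence the link by counting those above a level. *)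
Lemma gram_spectral n p (X : 'M[R]_(n, p)) :
  exists (U : 'M[C]_p) (r : 'I_p -> R), [/\ U \in unitmx,
    forall c : R, 0 <= c -> #|[pred j | c ^+ 2 < r j]| = count (> c) (singular_values X),
    forall v : 'cV[C]_p, \sum_j sqnorm ((U *m v) j 0) = cnorm v ^+ 2 &
    forall v : 'cV[C]_p, \sum_j r j * sqnorm ((U *m v) j 0) =
                         cnorm (map_mx f X *m v) ^+ 2].
Proof.
pose A : 'M[C]_p := map_mx f (X^T *m X).
have conjfM a b (M : 'M[R]_(a, b)) : map_mx Num.conj (map_mx f M) = map_mx f M.
  by apply/matrixP => i j; rewrite !mxE; apply/CrealP; rewrite complex_real.
have Aherm : A \is hermsymmx.
  apply/is_hermitianmxP; rewrite expr0 scale1r.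
  by rewrite -map_trmx /A conjfM map_trmx trmx_mul trmxK.
have /hermitian_normalmx /orthomx_spectralP := Aherm.
set U := spectralmx A; set d := spectral_diag A => A_eq.
have Uu : U \in unitmx := spectral_unit A.
have UV : invmx U = U^t* by apply: invmx_unitary; apply: spectral_unitarymx.
have [s_sorted s_ge0 s_char] := singular_valuesP X.
set s := singular_values X in s_sorted s_ge0 s_char *.
(* Both lists consist of the roots, with multiplicity, of the characteristic polynomial of [A]. *)
have ds : perm_eq [seq d 0 j | j : 'I_p] [seq f (x ^+ 2) | x <- s].
  apply: prod_XsubC_eq; rewrite big_image/= big_map.
  transitivity (char_poly A).
    rewrite A_eq char_poly_similar// char_poly_trig ?diag_mx_is_trig//.
    by apply: eq_bigr => j _; rewrite mxE eqxx mulr1n.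
  rewrite -map_char_poly s_char rmorph_prod; apply: eq_bigr => x _.
  by rewrite rmorphB/= map_polyX map_polyC.
pose r j := complex.Re (d 0 j).
have fr j : f (r j) = d 0 j.
  have : d 0 j \in [seq d 0 j | j : 'I_p] by apply: map_f; rewrite mem_enum.
  by rewrite (perm_mem ds) => /mapP[x _]; rewrite /r => ->.
exists U, r; split => //.
- move=> c c0.
  transitivity (count (fun z => c ^+ 2 < complex.Re z) [seq d 0 j | j : 'I_p]).
    rewrite count_map -size_filter cardE /enum_mem -filter_predI.
    by congr size; apply: eq_filter => j /=; rewrite andbT.
  rewrite (permP ds) count_map; apply: eq_in_count => x xs /=.
  by rewrite ltr_pXn2r// nnegrE (allP s_ge0).
- move=> v; rewrite -sqr_cnorm; apply: (fmorph_inj f).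
  rewrite !sqr_cnormE trmx_mul map_mxM mulmxA -(mulmxA _ _ U) -UV.
  by rewrite mulVmx// mulmx1.
- move=> v; apply: (fmorph_inj f).
  rewrite sqr_cnormE trmx_mul map_mxM (map_trmx f X) conjfM mulmxA.
  rewrite -(mulmxA _ _ (map_mx f X)) -map_mxM -/A A_eq UV.
  rewrite rmorph_sum.
  have -> : v ^t* *m (U ^t* *m diag_mx d *m U) *m v =
      (U *m v)^t* *m diag_mx d *m (U *m v).
    by rewrite trmx_mul map_mxM !mulmxA.
  rewrite mul_mx_diag [RHS]mxE; apply: eq_bigr => j _.
  by rewrite rmorphM/= fr [f _]sqnormE !mxE mulrCA mulrA.
Qed.

(** Dimension count: on vectors supported in J the system has k equations and #|J| > k unknowns. The
    matrix [B] embeds these vectors into the full space. *)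
Lemma kernel_vector k p (K : 'M[C]_(k, p)) (J : {pred 'I_p}) : (k < #|J|)%N ->
  exists2 w : 'cV[C]_p, w != 0 & K *m w = 0 /\ forall j, j \notin J -> w j 0 = 0.
Proof.
move=> kJ; pose B : 'M[C]_(p, #|J|) := \matrix_(i, t) (i == enum_val t)%:R.
have BE (y : 'cV[C]_#|J|) t : (B *m y) (enum_val t) 0 = y t 0.
  rewrite mxE (bigD1 t)//= mxE eqxx mul1r big1 ?addr0// => t' t't.
  by rewrite mxE (inj_eq enum_val_inj) eq_sym (negbTE t't) mul0r.
have : kermx (K *m B)^T != 0.
  rewrite kermx_eq0; apply/negP => /eqP rk.
  by have := rank_leq_col (K *m B)^T; rewrite rk leqNgt kJ.
move=> /rowV0Pn[y /sub_kermxP yK y0]; exists (B *m y^T).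
  apply: contraNneq y0 => By; apply/eqP/matrixP => i t.
  by rewrite ord1 mxE; have := BE y^T t; rewrite By !mxE.
split.
  by rewrite mulmxA -[K *m B]trmxK -trmx_mul yK trmx0.
move=> j jJ; rewrite mxE big1// => t _; rewrite mxE; case: eqP => [jt|_].
  by rewrite jt enum_valP in jJ.
by rewrite mul0r.
Qed.

(* One half of the Courant-Fischer formula: [singular_value_attained] is the
   other half. Complex kernels allow the spectral theorem of the library, which
   is stated over algebraically closed fields, to be used for the real X. *)
Lemma singular_value_le n p k k' (X : 'M[R]_(n, p)) (K : 'M[C]_(k', p)) (c : R) :
  (k' <= k)%N -> 0 <= c ->
  (forall v : 'cV[C]_p, K *m v = 0 -> cnorm (map_mx f X *m v) <= c * cnorm v) ->
  (singular_values X)`_k <= c.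
Proof.
move=> k'k c0 Kc; rewrite leNgt; apply/negP.
have [s_sorted _ _] := singular_valuesP X.
have [U [r [Uu rE UE XE]]] := gram_spectral X.
rewrite sorted_gt_nth// -rE//; set J := [pred j | _] => kJ.
(* In eigenvector coordinates [w] lives where the eigenvalues exceed c^2 and still satisfies the k'
   equations of [K], so that X stretches it by more than c. *)
have [w w0 [Kw wJ]] := kernel_vector (K *m invmx U) (leq_ltn_trans k'k kJ).
have wE : U *m (invmx U *m w) = w by rewrite mulmxA mulmxV// mul1mx.
have := Kc (invmx U *m w); rewrite mulmxA => /(_ Kw).
rewrite -(@ler_pXn2r _ 2)// ?nnegrE ?mulr_ge0 ?cnorm_ge0//.
rewrite exprMn -XE -UE wE leNgt => /negP; apply.
have [j0 wj0] : exists j, w j 0 != 0.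
  apply/existsP; apply: contraNT w0; rewrite negb_exists => /forallP w0.
  apply/eqP/matrixP => i j; rewrite ord1 mxE; have := w0 i.
  by rewrite negbK => /eqP.
have le_term j : c ^+ 2 * sqnorm (w j 0) <= r j * sqnorm (w j 0).
  have [jJ|/wJ ->] := boolP (j \in J).
    by rewrite ler_wpM2r ?sqnorm_ge0//; rewrite inE in jJ; exact: ltW.
  by rewrite /sqnorm/= expr0n/= addr0 !mulr0.
rewrite mulr_sumr (bigD1 j0)//= [ltRHS](bigD1 j0)//= ltr_leD//; last exact: ler_sum.
have j0J : j0 \in J by apply: contraNT wj0 => /wJ ->.
rewrite ltr_pM2r; first by rewrite inE in j0J.
by rewrite lt_neqAle sqnorm_ge0 andbT eq_sym; apply: contraNneq wj0 => /sqnorm_eq0 ->.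
Qed.

Lemma singular_value_attained n p k (X : 'M[R]_(n, p)) :
  exists k' (K : 'M[C]_(k', p)), (k' <= k)%N /\ forall v : 'cV[C]_p, K *m v = 0 ->
    cnorm (map_mx f X *m v) <= (singular_values X)`_k * cnorm v.
Proof.
have [s_sorted s_ge0 _] := singular_valuesP X.
have [U [r [Uu rE UE XE]]] := gram_spectral X.
set s := singular_values X in s_sorted s_ge0 rE *.
have sk0 : 0 <= s`_k.
  by have [ks|ks] := ltnP k (size s); [apply: all_nthP|rewrite nth_default].
(* The strict inequality leaves out eigenvalues tied with the k-th one, so that J has at most k
   elements. Ties can make it smaller, which is why the number k' of equations is not k itself. *)
pose J := [pred j | s`_k ^+ 2 < r j].
exists #|J|, (\matrix_(t, i) U (enum_val t) i); split.
  by rewrite rE// leqNgt -sorted_gt_nth// ltxx.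
move=> v Kv; rewrite -(@ler_pXn2r _ 2)// ?nnegrE ?mulr_ge0 ?cnorm_ge0//.
rewrite exprMn -XE -UE mulr_sumr; apply: ler_sum => j _.
have [jJ|jJ] := boolP (j \in J); last first.
  by rewrite ler_wpM2r ?sqnorm_ge0//; rewrite inE -leNgt in jJ.
suff -> : (U *m v) j 0 = 0 by rewrite /sqnorm/= expr0n/= addr0 !mulr0.
have /matrixP/(_ (enum_rank_in jJ j) 0) := Kv; rewrite !mxE => Kv0.
rewrite -[RHS]Kv0; apply: eq_bigr => i _.
by rewrite mxE enum_rankK_in.
Qed.

(** Weyl's perturbation inequality: on a kernel that is optimal for Y, passing to X costs at most
    the norm of X - Y. It serves the measurability of singular values. *)
Lemma singular_value_lipschitz n p (X Y : 'M[R]_(n, p)) k :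
  `|(singular_values X)`_k - (singular_values Y)`_k| <= opnorm (X - Y).
Proof.
have weyl (A B : 'M[R]_(n, p)) :
    (singular_values A)`_k <= opnorm (A - B) + (singular_values B)`_k.
  have [k' [K [k'k KB]]] := singular_value_attained k B.
  have [_ s_ge0 _] := singular_valuesP B.
  have sk0 : 0 <= (singular_values B)`_k.
    have [ks|ks] := ltnP k (size (singular_values B)); last by rewrite nth_default.
    exact: all_nthP.
  apply: (singular_value_le (K := K) k'k) => [|v Kv]; first by rewrite addr_ge0 ?opnorm_ge0.
  rewrite -{1}(subrK B A) map_mxD mulmxDl (le_trans (cnorm_triangle _ _))//.
  by rewrite mulrDl lerD ?cnorm_mulmx_le// KB.
have := weyl X Y; have := weyl Y X.
have := opnormZ_le (-1) (X - Y); rewrite scaleN1r opprB normrN1 mul1r => h1 h2 h3.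
by rewrite ler_norml; apply/andP; split; lra.
Qed.

(** X acts as N on the common kernel of the z_i^T, which is cut out by k equations whether or not
    the z_i are independent. Lists are indexed from 0, so entry k is sigma_{k+1}. *)
Lemma singular_value_low_rank n p k (X N : 'M[R]_(n, p)) (theta : 'I_k -> R)
    (u : 'I_k -> 'cV[R]_n) (z : 'I_k -> 'cV[R]_p) :
  X = \sum_(i < k) theta i *: (u i *m (z i)^T) + N ->
  (singular_values X)`_k <= opnorm N.
Proof.
move=> XE; pose K : 'M[C]_(k, p) := \matrix_(i, j) f (z i j 0).
apply: (singular_value_le (K := K) (leqnn k)) => [|v Kv]; first exact: opnorm_ge0.
suff -> : map_mx f X *m v = map_mx f N *m v by exact: cnorm_mulmx_le.
rewrite XE map_mxD mulmxDl map_mx_sum mulmx_suml big1 ?add0r// => i _.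
rewrite map_mxZ map_mxM -scalemxAl -mulmxA.
suff -> : map_mx f (z i)^T *m v = 0 by rewrite mulmx0 scaler0.
apply/matrixP => a b; rewrite !ord1.
have /matrixP/(_ i 0) := Kv; rewrite !mxE => Kv0; rewrite -[RHS]Kv0.
by apply: eq_bigr => j _; rewrite !mxE.
Qed.

End SingularValues.

(** * Biased random signs *)

Section SignMeans.
Context {R : realType}.
Implicit Types I : finType.

Definition sgn (e : bool) : R := (-1) ^+ e.

Lemma sqr_sgn e : sgn e * sgn e = 1.
Proof. by case: e; rewrite /sgn ?expr0 ?expr1; ring. Qed.

(** For biases in [-1, 1], the product law of independent signs with means [b i]; zero bias is the
    uniform law. *)
Definition bias_weight I (b : I -> R) (s : {ffun I -> bool}) : R :=
  \prod_i ((1 + b i * sgn (s i)) / 2).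

Definition bias_mean I (b : I -> R) (F : {ffun I -> bool} -> R) : R :=
  \sum_s bias_weight b s * F s.

Lemma bias_mean_prod I (b : I -> R) (g : I -> bool -> R) :
  bias_mean b (fun s => \prod_i g i (s i)) =
  \prod_i ((1 - b i) / 2 * g i true + (1 + b i) / 2 * g i false).
Proof.
transitivity (\prod_i \sum_(e : bool) (1 + b i * sgn e) / 2 * g i e).
  by rewrite bigA_distr_bigA; apply: eq_bigr => s _; rewrite -big_split.
apply: eq_bigr => i _; rewrite big_bool /sgn/= ?expr0 ?expr1 mulr1 mulrN1.
by rewrite addrC.
Qed.

Lemma bias_mean_cst I (b : I -> R) (c : R) : bias_mean b (fun=> c) = c.
Proof.
have := bias_mean_prod b (fun _ _ => 1); rewrite [RHS]big1 => [E|i _]; last by lra.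
rewrite /bias_mean -mulr_suml -[RHS]mul1r; congr (_ * _); rewrite -[RHS]E.
by apply: eq_bigr => s _; rewrite big1 ?mulr1.
Qed.

Lemma eq_bias_mean I (b : I -> R) F G : F =1 G -> bias_mean b F = bias_mean b G.
Proof. by move=> FG; apply: eq_bigr => s _; rewrite FG. Qed.

Lemma bias_mean_sum I (b : I -> R) (J : finType) (F : J -> {ffun I -> bool} -> R) :
  bias_mean b (fun s => \sum_j F j s) = \sum_j bias_mean b (F j).
Proof.
by rewrite exchange_big; apply: eq_bigr => s _; rewrite mulr_sumr.
Qed.

Lemma bias_meanD I (b : I -> R) F G :
  bias_mean b (fun s => F s + G s) = bias_mean b F + bias_mean b G.
Proof. by rewrite -big_split; apply: eq_bigr => s _; rewrite mulrDr. Qed.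

Lemma bias_meanZ I (b : I -> R) c F :
  bias_mean b (fun s => c * F s) = c * bias_mean b F.
Proof. by rewrite mulr_sumr; apply: eq_bigr => s _; rewrite mulrCA. Qed.

Lemma bias_mean_exchange I (J : finType) (b : I -> R) (c : J -> R) F :
  bias_mean b (fun s => bias_mean c (fun t => F s t)) =
  bias_mean c (fun t => bias_mean b (fun s => F s t)).
Proof.
rewrite /bias_mean.
under eq_bigr do rewrite mulr_sumr.
rewrite exchange_big; apply: eq_bigr => t _; rewrite mulr_sumr.
by apply: eq_bigr => s _; rewrite mulrCA.
Qed.

Lemma bias_mean_sgn I (b : I -> R) i : bias_mean b (fun s => sgn (s i)) = b i.
Proof.
have := bias_mean_prod b (fun j e => if j == i then sgn e else 1).
rewrite [RHS](bigD1 i)//= eqxx big1 => [E|j /negbTE ->]; last by lra.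
transitivity (bias_mean b (fun s => \prod_j (if j == i then sgn (s j) else 1))).
  apply: eq_bias_mean => s; rewrite (bigD1 i)//= eqxx big1 ?mulr1// => j.
  by move/negbTE ->.
by rewrite E /sgn/= ?expr0 ?expr1; lra.
Qed.

Lemma bias_mean_sgn2 I (b : I -> R) i j : i != j ->
  bias_mean b (fun s => sgn (s i) * sgn (s j)) = b i * b j.
Proof.
move=> ij; have ji : j != i by rewrite eq_sym.
have := bias_mean_prod b (fun l e => if (l == i) || (l == j) then sgn e else 1).
rewrite [RHS](bigD1 i)//= (bigD1 j)//= !eqxx orbT/= big1; last first.
  by move=> l /andP[/negbTE -> /negbTE ->] /=; lra.
move=> E; transitivity (bias_mean b (fun s =>
    \prod_l (if (l == i) || (l == j) then sgn (s l) else 1))).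
  apply: eq_bias_mean => s; rewrite (bigD1 i)//= (bigD1 j)//= !eqxx orbT/=.
  by rewrite big1 ?mulr1// => l /andP[/negbTE -> /negbTE ->].
by rewrite E /sgn/= ?expr0 ?expr1; lra.
Qed.

Section Bounded.
Variables (I : finType) (b : I -> R).
Hypothesis b_le1 : forall i, `|b i| <= 1.

Lemma bias_weight_ge0 s : 0 <= bias_weight b s.
Proof.
apply: prodr_ge0 => i _; apply: divr_ge0 => //.
have := b_le1 i; rewrite ler_norml => /andP[? ?].
by rewrite /sgn; case: (s i); rewrite /= ?expr0 ?expr1; lra.
Qed.

Lemma le_bias_mean F G : (forall s, F s <= G s) -> bias_mean b F <= bias_mean b G.
Proof. by move=> FG; apply: ler_sum => s _; rewrite ler_wpM2l ?bias_weight_ge0. Qed.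

(** Jensen's inequality, from the tangent line of the exponential at the mean [m]. *)
Lemma expR_bias_mean F : expR (bias_mean b F) <= bias_mean b (expR \o F).
Proof.
set m := bias_mean b F.
have -> : expR m = bias_mean b (fun s => expR m * (1 + (F s - m))).
  rewrite bias_meanZ bias_meanD bias_mean_cst bias_meanD bias_mean_cst -/m.
  by rewrite subrr addr0 mulr1.
apply: le_bias_mean => s /=.
have -> : expR (F s) = expR m * expR (F s - m) by rewrite -expRD subrKC.
by rewrite ler_wpM2l ?expR_ge0 ?expR_ge1Dx.
Qed.

(* Donsker-Varadhan lower bound: [sum b i ^ 2] dominates the relative entropy
   of the biased signs with respect to the uniform ones. *)
Lemma expR_bias_mean_entropy F :
  expR (bias_mean b F - \sum_i b i ^+ 2) <= bias_mean (fun=> 0) (expR \o F).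
Proof.
(* The sum of the b_i^2 is the biased mean of sum_i b_i s_i, and this last sum dominates the
   logarithm of the density pointwise because 1 + y <= exp y. *)
have -> : bias_mean b F - \sum_i b i ^+ 2 =
    bias_mean b (fun s => F s + - \sum_i b i * sgn (s i)).
  rewrite bias_meanD; congr (_ + _).
  transitivity (bias_mean b (fun s => -1 * \sum_i b i * sgn (s i))).
    rewrite bias_meanZ bias_mean_sum mulN1r; congr (- _).
    by apply: eq_bigr => i _; rewrite bias_meanZ bias_mean_sgn expr2.
  by apply: eq_bias_mean => s; rewrite mulN1r.
apply: (le_trans (expR_bias_mean _)); apply: ler_sum => s _ /=.
rewrite expRD mulrCA [leRHS]mulrC ler_wpM2l ?expR_ge0//.
rewrite -sumrN expR_sum -big_split/=; apply: ler_prod => i _.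
have y1 : 0 <= 1 + b i * sgn (s i).
  have := b_le1 i; rewrite ler_norml => /andP[? ?].
  by rewrite /sgn; case: (s i); rewrite /= ?expr0 ?expr1; lra.
rewrite mulr_ge0 ?expR_ge0 ?divr_ge0//= mul0r addr0 mulrAC ler_pM2r ?invr_gt0//.
by rewrite expRN ler_pdivrMr ?expR_gt0// mul1r expR_ge1Dx.
Qed.

End Bounded.

(** The constant 2 instead of the optimal 1/2 allows an elementary proof: up to x = 1/2, exp y <= 1
    / (1 - y) at y = x and y = - x gives 1 / (1 - x^2) <= 1 + 2 x^2; beyond 1/2, x <= 2 x^2. *)
Lemma cosh_le (x : R) : (expR x + expR (- x)) / 2 <= expR (2 * x ^+ 2).
Proof.
wlog x0 : x / 0 <= x.
  move=> H; have [/H//|/ltW x0] := leP 0 x.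
  by have := H (- x); rewrite oppr_ge0 opprK sqrrN addrC; apply.
have [x_le|x_gt] := leP x (1 / 2).
  have e1 : expR x <= (1 - x)^-1.
    rewrite -[x in leLHS]opprK expRN lef_pV2 ?posrE ?expR_gt0//; last by lra.
    exact: expR_ge1Dx.
  have e2 : expR (- x) <= (1 + x)^-1.
    rewrite expRN lef_pV2 ?posrE ?expR_gt0//; last by lra.
    exact: expR_ge1Dx.
  have e3 : 1 + 2 * x ^+ 2 <= expR (2 * x ^+ 2) by exact: expR_ge1Dx.
  apply: le_trans e3; apply: (@le_trans _ _ (((1 - x)^-1 + (1 + x)^-1) / 2)).
    by rewrite ler_wpM2r ?invr_ge0 ?lerD.
  have -> : ((1 - x)^-1 + (1 + x)^-1) / 2 = (1 - x ^+ 2)^-1.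
    by field; rewrite !gt_eqF//; nra.
  have y0 : 0 <= x ^+ 2 by exact: sqr_ge0.
  have y1 : x ^+ 2 <= 1 / 2 by nra.
  move: (x ^+ 2) y0 y1 => y y0 y1.
  rewrite -[leLHS]mul1r ler_pdivrMr; first by nra.
  by lra.
apply: (@le_trans _ _ (expR x)).
  have : expR (- x) <= expR x by rewrite ler_expR; lra.
  by lra.
by rewrite ler_expR; nra.
Qed.

Lemma sign_mgf I (c : I -> R) :
  bias_mean (fun=> 0) (fun s => expR (\sum_i c i * sgn (s i))) <=
  expR (2 * \sum_i c i ^+ 2).
Proof.
rewrite mulr_sumr expR_sum.
have -> : bias_mean (fun=> 0) (fun s => expR (\sum_i c i * sgn (s i))) =
    bias_mean (fun=> 0) (fun s => \prod_i expR (c i * sgn (s i))).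
  by apply: eq_bias_mean => s; rewrite expR_sum.
rewrite (bias_mean_prod _ (fun i e => expR (c i * sgn e))).
apply: ler_prod => i _.
have := cosh_le (c i); have := expR_ge0 (c i); have := expR_ge0 (- c i).
rewrite /sgn/= ?expr0 ?expr1 mulr1 mulrN1 => h1 h2 h3.
by apply/andP; split; lra.
Qed.

End SignMeans.

(** * Expected operator norm of a signed rank-one matrix *)

Section RademacherRankOne.
Context {R : realType}.

Lemma bias_mean_mul (I J : finType) (b : I -> R) (c : J -> R) F G :
  bias_mean b (fun s => bias_mean c (fun t => F s * G t)) =
  bias_mean b F * bias_mean c G.
Proof.
rewrite [RHS]mulrC -bias_meanZ; apply: eq_bias_mean => s.
by rewrite bias_meanZ mulrC.
Qed.

(** Entropies of independent families add up: the one-family bound is applied in t for each fixed s,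
    then in s. *)
Lemma expR_bias_mean2_entropy (I J : finType) (b : I -> R) (c : J -> R)
    (F : {ffun I -> bool} -> {ffun J -> bool} -> R) :
  (forall i, `|b i| <= 1) -> (forall j, `|c j| <= 1) ->
  expR (bias_mean b (fun s => bias_mean c (F s)) -
        (\sum_i b i ^+ 2 + \sum_j c j ^+ 2)) <=
  bias_mean (fun=> 0) (fun s => bias_mean (fun=> 0) (fun t => expR (F s t))).
Proof.
move=> b1 c1; set B := \sum_i b i ^+ 2; set D := \sum_j c j ^+ 2.
apply: (@le_trans _ _ (bias_mean (fun=> 0) (expR \o
    (fun s => bias_mean c (F s) + - D)))); last first.
  apply: le_bias_mean => [i|s]; first by rewrite normr0.
  exact: expR_bias_mean_entropy.
have := expR_bias_mean_entropy b1 (fun s => bias_mean c (F s) + - D).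
by apply: le_trans; rewrite ler_expR bias_meanD bias_mean_cst -/B; lra.
Qed.

(* The sum of K rescaled signs plays the role of a Gaussian coordinate of
   variance [alpha ^+ 2 * K]: biasing the signs moves its mean to any x with
   |x| <= alpha K without increasing its variance. *)
Definition smooth_coord (I : finType) (K : nat) (alpha : R) (i : I)
  (s : {ffun I * 'I_K -> bool}) : R := alpha * \sum_(l < K) sgn (s (i, l)).

Definition smooth_bias (I : finType) (K : nat) (alpha : R) (x : I -> R)
  (il : I * 'I_K) : R := x il.1 / (alpha * K%:R).

Section Smooth.
Variables (I : finType) (K : nat) (alpha : R) (x : I -> R).
Hypotheses (K_gt0 : (0 < K)%N) (alpha_gt0 : 0 < alpha).

Let K0 : K%:R != 0 :> R. Proof. by rewrite pnatr_eq0 -lt0n. Qed.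
Let a0 : alpha != 0. Proof. by rewrite gt_eqF. Qed.

Lemma smooth_mean i :
  bias_mean (smooth_bias (K := K) alpha x) (smooth_coord alpha i) = x i.
Proof.
rewrite bias_meanZ bias_mean_sum.
under eq_bigr do rewrite bias_mean_sgn /smooth_bias/=.
by rewrite sumr_const card_ord -mulr_natl; field; rewrite K0 a0.
Qed.

Lemma smooth_sqr_mean i :
  bias_mean (smooth_bias (K := K) alpha x) (fun s => smooth_coord alpha i s ^+ 2)
  <= x i ^+ 2 + alpha ^+ 2 * K%:R.
Proof.
set b := smooth_bias alpha x.
have -> : bias_mean b (fun s => smooth_coord alpha i s ^+ 2) =
    alpha ^+ 2 * \sum_(l < K) \sum_(m < K)
      bias_mean b (fun s => sgn (s (i, l)) * sgn (s (i, m))).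
  under eq_bigr do rewrite -bias_mean_sum.
  rewrite -bias_mean_sum -bias_meanZ; apply: eq_bias_mean => s.
  by rewrite /smooth_coord exprMn expr2 [(\sum_(l < K) _) ^+ 2]expr2 big_distrlr.
(* [c] is the common mean of the K signs at coordinate i. Pairs of distinct signs contribute c^2;
   the diagonal value 1 is relaxed to c^2 + 1, which makes the total exactly x_i^2 + alpha^2 K. *)
pose c := x i / (alpha * K%:R).
apply: (@le_trans _ _ (alpha ^+ 2 *
    \sum_(l < K) \sum_(m < K) (c ^+ 2 + (l == m)%:R))).
  rewrite ler_wpM2l ?sqr_ge0//; apply: ler_sum => l _; apply: ler_sum => m _.
  have [<-|lm] := eqVneq l m.
    have -> : bias_mean b (fun s => sgn (s (i, l)) * sgn (s (i, l))) = 1.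
      by rewrite -[RHS](bias_mean_cst b); apply: eq_bias_mean => s; rewrite sqr_sgn.
    by rewrite lerDr sqr_ge0.
  rewrite bias_mean_sgn2; last by apply: contra lm => /eqP[->].
  by rewrite addr0 expr2.
have -> : \sum_(l < K) \sum_(m < K) (c ^+ 2 + (l == m)%:R) =
    K%:R * (K%:R * c ^+ 2 + 1).
  transitivity (\sum_(l < K) (K%:R * c ^+ 2 + 1)); last first.
    by rewrite sumr_const card_ord -[LHS]mulr_natl.
  apply: eq_bigr => l _; rewrite big_split/= sumr_const card_ord -[c ^+ 2 *+ K]mulr_natl.
  congr (_ + _); rewrite (bigD1 l)//= eqxx big1 ?addr0// => m.
  by rewrite eq_sym => /negbTE ->.
by rewrite le_eqVlt /c; apply/orP; left; apply/eqP; field; rewrite K0 a0.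
Qed.

(** The entropy cost of moving the means to x: as for a Gaussian shift, squared length over
    variance. *)
Lemma smooth_bias_sqr :
  \sum_il smooth_bias (K := K) alpha x il ^+ 2 =
  (\sum_i x i ^+ 2) / (alpha ^+ 2 * K%:R).
Proof.
rewrite -(pair_bigA _ (fun i l => smooth_bias (K := K) alpha x (i, l) ^+ 2))/=.
rewrite mulr_suml; apply: eq_bigr => i _.
rewrite /smooth_bias/= sumr_const card_ord -[LHS]mulr_natl; field.
by rewrite K0 a0.
Qed.

Lemma smooth_bias_le1 : (forall i, `|x i| <= alpha * K%:R) ->
  forall il, `|smooth_bias (K := K) alpha x il| <= 1.
Proof.
move=> xK il; have aK : 0 < alpha * K%:R by rewrite mulr_gt0// ltr0n.
by rewrite normrM normfV (gtr0_norm aK) ler_pdivrMr// mul1r.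
Qed.

End Smooth.

(** One M^2 comes from the means, as |w_i| <= M and |x| <= 1. The other comes from the variance
    alpha^2 K, which is assumed small enough to compensate the squared norm of w. *)
Lemma smooth_weighted_mean n K (alpha M : R) (w x : 'cV[R]_n) :
  (0 < K)%N -> 0 < alpha -> (forall i, `|w i 0| <= M) ->
  norm2 x <= 1 -> norm2 w ^+ 2 * (alpha ^+ 2 * K%:R) <= M ^+ 2 ->
  (forall i, `|x i 0| <= alpha * K%:R) ->
  0 <= bias_mean (smooth_bias (K := K) alpha (fun i => x i 0))
    (fun s => \sum_i w i 0 ^+ 2 * smooth_coord alpha i s ^+ 2) <= 2 * M ^+ 2.
Proof.
move=> K0 a0 wM x1 wK xK; set b := smooth_bias _ _.
have b1 il : `|b il| <= 1 by exact: smooth_bias_le1.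
apply/andP; split.
  rewrite -[leLHS](bias_mean_cst b); apply: le_bias_mean => // s.
  by apply: sumr_ge0 => i _; rewrite mulr_ge0 ?sqr_ge0.
rewrite bias_mean_sum; apply: (@le_trans _ _ (\sum_i (M ^+ 2 * x i 0 ^+ 2 +
    w i 0 ^+ 2 * (alpha ^+ 2 * K%:R)))).
  apply: ler_sum => i _; rewrite bias_meanZ.
  apply: (le_trans (ler_wpM2l (sqr_ge0 _)
    (smooth_sqr_mean (fun i => x i 0) K0 a0 i))).
  rewrite mulrDr lerD2r ler_wpM2r ?sqr_ge0// -real_normK ?num_real//.
  by rewrite ler_pXn2r// nnegrE// (le_trans _ (wM i)).
rewrite big_split/= -mulr_sumr -mulr_suml -!sqr_norm2 mulr2n mulrDl mul1r lerD//.
by rewrite ler_piMr ?sqr_ge0// expr_le1// norm2_ge0.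
Qed.

(* PAC-Bayes argument. The exponential moment of
   F r s t = lam X(s)^T M(r) Y(t) - 2 lam^2 |u X(s)|^2 |z Y(t)|^2 over the signs
   r is at most 1 for fixed s and t. Biasing s and t so that X and Y have means y and x
   then bounds lam y^T M(r) x uniformly in the unit vectors x and y, with
   K alpha^2 = (Mu / |u|)^2 and lam balancing the entropy against the variance. *)
Lemma mean_opnorm_rank_one_pos n p (u : 'cV[R]_n) (z : 'cV[R]_p) (Mu Mz : R) :
  0 < Mu -> 0 < Mz -> (forall i, `|u i 0| <= Mu) -> (forall j, `|z j 0| <= Mz) ->
  0 < norm2 u -> 0 < norm2 z ->
  bias_mean (fun=> 0) (fun s : {ffun 'I_n * 'I_p -> bool} =>
    opnorm (\matrix_(i, j) (sgn (s (i, j)) * (u i 0 * z j 0)))) <=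
  9 * (norm2 u * Mz + norm2 z * Mu).
Proof.
move=> Mu0 Mz0 uM zM u0 z0.
pose a := norm2 u / Mu; pose b := norm2 z / Mz.
have a0 : 0 < a by rewrite divr_gt0.
have b0 : 0 < b by rewrite divr_gt0.
pose lam := (a + b) / (Mu * Mz).
have lam0 : 0 < lam by apply: divr_gt0; [exact: addr_gt0 | exact: mulr_gt0].
(* K only has to be large: al K = sqrt K / a and be K = sqrt K / b must be at least 1 for every unit
   vector to be reachable with biases in [-1, 1]. *)
pose K := (Num.truncn (a ^+ 2 + b ^+ 2)).+1.
have Kab : a ^+ 2 + b ^+ 2 <= K%:R by apply: ltW; exact: truncnS_gt.
have K0 : 0 < K%:R :> R by rewrite ltr0n.
pose al := Num.sqrt (a ^- 2 / K%:R); pose be := Num.sqrt (b ^- 2 / K%:R).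
have al0 : 0 < al by rewrite sqrtr_gt0 divr_gt0 ?invr_gt0 ?exprn_gt0.
have be0 : 0 < be by rewrite sqrtr_gt0 divr_gt0 ?invr_gt0 ?exprn_gt0.
have alE : al ^+ 2 * K%:R = a ^- 2.
  by rewrite sqr_sqrtr ?divfK ?gt_eqF// divr_ge0 ?invr_ge0 ?exprn_ge0 ?ltW.
have beE : be ^+ 2 * K%:R = b ^- 2.
  by rewrite sqr_sqrtr ?divfK ?gt_eqF// divr_ge0 ?invr_ge0 ?exprn_ge0 ?ltW.
have alK : 1 <= al * K%:R.
  rewrite -(@expr_ge1 _ 2)//; last by rewrite ltW// mulr_gt0.
  have -> : (al * K%:R) ^+ 2 = al ^+ 2 * K%:R * K%:R by ring.
  rewrite alE mulrC ler_pdivlMr ?exprn_gt0// mul1r.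
  by apply: le_trans Kab; rewrite lerDl sqr_ge0.
have beK : 1 <= be * K%:R.
  rewrite -(@expr_ge1 _ 2)//; last by rewrite ltW// mulr_gt0.
  have -> : (be * K%:R) ^+ 2 = be ^+ 2 * K%:R * K%:R by ring.
  rewrite beE mulrC ler_pdivlMr ?exprn_gt0// mul1r.
  by apply: le_trans Kab; rewrite lerDr sqr_ge0.
pose X (i : 'I_n) (s : {ffun 'I_n * 'I_K -> bool}) := smooth_coord al i s.
pose Y (j : 'I_p) (t : {ffun 'I_p * 'I_K -> bool}) := smooth_coord be j t.
pose A s := \sum_i u i 0 ^+ 2 * X i s ^+ 2.
pose B t := \sum_j z j 0 ^+ 2 * Y j t ^+ 2.
pose M (r : {ffun 'I_n * 'I_p -> bool}) : 'M[R]_(n, p) :=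
  \matrix_(i, j) (sgn (r (i, j)) * (u i 0 * z j 0)).
pose F r s t := lam * (\sum_i \sum_j M r i j * (X i s * Y j t)) +
  (- 2 * lam ^+ 2) * (A s * B t).
pose Z r := bias_mean (fun=> 0) (fun s => bias_mean (fun=> 0) (fun t => expR (F r s t))).
(* The mean over [r] is taken first. The term subtracted in [F] is exactly the exponent allowed by
   [sign_mgf] for the coefficients [c]. *)
have Z1 : bias_mean (fun=> 0) Z <= 1.
  rewrite bias_mean_exchange -[leRHS](bias_mean_cst (fun _ : 'I_n * 'I_K => 0)).
  apply: le_bias_mean => [i|s]; first by rewrite normr0.
  rewrite bias_mean_exchange -[leRHS](bias_mean_cst (fun _ : 'I_p * 'I_K => 0)).
  apply: le_bias_mean => [i|t]; first by rewrite normr0.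
  pose c (ij : 'I_n * 'I_p) := lam * (u ij.1 0 * z ij.2 0) * (X ij.1 s * Y ij.2 t).
  have cE : \sum_ij c ij ^+ 2 = lam ^+ 2 * (A s * B t).
    rewrite -(pair_bigA _ (fun i j => c (i, j) ^+ 2))/= /A /B big_distrlr/= mulr_sumr.
    apply: eq_bigr => i _; rewrite mulr_sumr; apply: eq_bigr => j _.
    by rewrite /c/=; ring.
  have -> : bias_mean (fun=> 0) (fun r => expR (F r s t)) =
      expR (- 2 * (lam ^+ 2 * (A s * B t))) *
      bias_mean (fun=> 0) (fun r => expR (\sum_ij c ij * sgn (r ij))).
    rewrite -bias_meanZ; apply: eq_bias_mean => r; rewrite -expRD; congr expR.
    rewrite /F addrC; congr (_ + _); first by ring.
    transitivity (\sum_i \sum_j c (i, j) * sgn (r (i, j))); last first.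
      by rewrite pair_bigA; apply: eq_bigr => -[].
    rewrite mulr_sumr.
    apply: eq_bigr => i _; rewrite mulr_sumr; apply: eq_bigr => j _.
    by rewrite mxE /c/=; ring.
  rewrite mulNr expRN mulrC ler_pdivrMr ?expR_gt0// mul1r -cE.
  exact: sign_mgf.
(* 8 (a + b)^2 is 2 lam^2 (2 Mu^2) (2 Mz^2), the bound on the mean of the subtracted term; a^2 + b^2
   bounds the entropy. Dividing D <= 9 (a + b)^2 by lam gives the final 9 (a + b) Mu Mz. *)
pose D := 8 * (a + b) ^+ 2 + (a ^+ 2 + b ^+ 2).
have MZ r : opnorm (M r) <= (Z r - 1 + D) / lam.
  have bil (y : 'cV[R]_n) (x : 'cV[R]_p) : norm2 y <= 1 -> norm2 x <= 1 ->
      \sum_(i < n) \sum_(j < p) y i 0 * M r i j * x j 0 <= (Z r - 1 + D) / lam.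
    move=> y1 x1; set L := \sum_i _.
    rewrite ler_pdivlMr// mulrC.
    have yK i : `|y i 0| <= al * K%:R.
      by rewrite (le_trans (entry_le_norm2 _ _))// (le_trans y1).
    have xK i : `|x i 0| <= be * K%:R.
      by rewrite (le_trans (entry_le_norm2 _ _))// (le_trans x1).
    pose bx := smooth_bias (K := K) al (fun i => y i 0).
    pose bz := smooth_bias (K := K) be (fun j => x j 0).
    have bx1 il : `|bx il| <= 1 by exact: smooth_bias_le1.
    have bz1 il : `|bz il| <= 1 by exact: smooth_bias_le1.
    have /andP[EA0 EA] : 0 <= bias_mean bx A <= 2 * Mu ^+ 2.
      apply: smooth_weighted_mean => //.
      by rewrite alE /a expr_div_n invf_div mulrC divfK// expf_neq0// gt_eqF.
    have /andP[EB0 EB] : 0 <= bias_mean bz B <= 2 * Mz ^+ 2.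
      apply: smooth_weighted_mean => //.
      by rewrite beE /b expr_div_n invf_div mulrC divfK// expf_neq0// gt_eqF.
    have FE : bias_mean bx (fun s => bias_mean bz (F r s)) =
        lam * L + (- 2 * lam ^+ 2) * (bias_mean bx A * bias_mean bz B).
      have -> : bias_mean bx (fun s => bias_mean bz (F r s)) =
          bias_mean bx (fun s => lam * (\sum_i \sum_j M r i j *
             bias_mean bz (fun t => X i s * Y j t)) +
             (- 2 * lam ^+ 2) * bias_mean bz (fun t => A s * B t)).
        apply: eq_bias_mean => s; rewrite /F bias_meanD !bias_meanZ; congr (_ * _ + _).
        rewrite bias_mean_sum; apply: eq_bigr => i _.
        by rewrite bias_mean_sum; apply: eq_bigr => j _; rewrite bias_meanZ.
      rewrite bias_meanD !bias_meanZ bias_mean_mul; congr (_ * _ + _).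
      rewrite bias_mean_sum; apply: eq_bigr => i _.
      rewrite bias_mean_sum; apply: eq_bigr => j _.
      by rewrite bias_meanZ bias_mean_mul !smooth_mean// mulrCA mulrA.
    have := expR_bias_mean2_entropy (F r) bx1 bz1.
    rewrite -/(Z r) FE !smooth_bias_sqr// -!sqr_norm2 alE beE !invrK.
    (* With 1 + h <= exp h the bound becomes affine in [Z r], so that its mean over [r] is
       controlled by [Z1] directly. *)
    move=> /(le_trans (expR_ge1Dx _)).
    have AB : bias_mean bx A * bias_mean bz B <= 4 * (Mu * Mz) ^+ 2.
      apply: (le_trans (ler_pM EA0 EB0 EA EB)).
      by rewrite exprMn; lra.
    have lamE : lam ^+ 2 * (4 * (Mu * Mz) ^+ 2) = 4 * (a + b) ^+ 2.
      by rewrite /lam; field; rewrite !gt_eqF.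
    have lAB : lam ^+ 2 * (bias_mean bx A * bias_mean bz B) <= 4 * (a + b) ^+ 2.
      by rewrite -lamE ler_wpM2l ?sqr_ge0.
    have y2 : norm2 y ^+ 2 * a ^+ 2 <= a ^+ 2.
      by rewrite ler_piMl ?sqr_ge0// expr_le1// norm2_ge0.
    have x2 : norm2 x ^+ 2 * b ^+ 2 <= b ^+ 2.
      by rewrite ler_piMl ?sqr_ge0// expr_le1// norm2_ge0.
    by rewrite /D; lra.
  (* The choice y = x = 0 shows that the bound is nonnegative. *)
  apply: opnorm_le_bilinear => //; have := bil 0 0; rewrite !norm20 ler01.
  rewrite big1 => [|i _]; last by rewrite big1// => j _; rewrite !mxE !mul0r.
  exact.
apply: (@le_trans _ _ (bias_mean (fun=> 0) (fun r => lam^-1 * (Z r + (D - 1))))).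
  apply: le_bias_mean => [i|r]; first by rewrite normr0.
  by rewrite (le_trans (MZ r))// mulrC -addrA [D - 1]addrC.
rewrite bias_meanZ bias_meanD bias_mean_cst.
apply: (@le_trans _ _ (lam^-1 * D)).
  by rewrite ler_pM2l ?invr_gt0//; lra.
have DE : D <= 9 * (a + b) ^+ 2.
  have := mulr_gt0 a0 b0; rewrite /D sqrrD; lra.
apply: (@le_trans _ _ (lam^-1 * (9 * (a + b) ^+ 2))).
  by rewrite ler_pM2l ?invr_gt0.
rewrite le_eqVlt; apply/orP; left; apply/eqP; rewrite /lam /a /b; field.
by rewrite !gt_eqF// addr_gt0 ?mulr_gt0.
Qed.

End RademacherRankOne.

(** * Signed low-rank matrices and sample quantiles *)

Section SignedSignal.
Context {R : realType}.

Lemma norm_sup_entry n (u : 'cV[R]_n) i : `|u i 0| <= norm_sup u.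
Proof.
rewrite /norm_sup [leRHS]/Num.Def.normr/= mx_normrE.
exact: (le_bigmax _ (fun ij : 'I_n * 'I_1 => `|u ij.1 ij.2|) (i, 0)).
Qed.

Lemma mean_opnorm_rank_one n p (u : 'cV[R]_n) (z : 'cV[R]_p) :
  bias_mean (fun=> 0) (fun s : {ffun 'I_n * 'I_p -> bool} =>
    opnorm (\matrix_(i, j) (sgn (s (i, j)) * (u i 0 * z j 0)))) <=
  9 * (norm2 u * norm_sup z + norm2 z * norm_sup u).
Proof.
have rhs0 : 0 <= 9 * (norm2 u * norm_sup z + norm2 z * norm_sup u).
  by rewrite mulr_ge0 ?addr_ge0// /norm_sup mulr_ge0 ?norm2_ge0 ?normr_ge0.
have opnorm_rank0 : (forall i j, u i 0 * z j 0 = 0) ->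
    bias_mean (fun=> 0) (fun s : {ffun 'I_n * 'I_p -> bool} =>
      opnorm (\matrix_(i, j) (sgn (s (i, j)) * (u i 0 * z j 0)))) = 0 :> R.
  move=> uz0; rewrite -[RHS](bias_mean_cst (fun _ : 'I_n * 'I_p => 0)).
  apply: eq_bias_mean => s; rewrite -[RHS](opnorm0 n p); congr opnorm.
  by apply/matrixP => i j; rewrite !mxE uz0 mulr0.
have [u0|u0] := eqVneq u 0.
  by rewrite opnorm_rank0// => i j; rewrite u0 mxE mul0r.
have [z0|z0] := eqVneq z 0.
  by rewrite opnorm_rank0// => i j; rewrite z0 mxE mulr0.
apply: mean_opnorm_rank_one_pos; rewrite ?normr_gt0//.
- exact: norm_sup_entry.
- exact: norm_sup_entry.
- by rewrite lt_neqAle norm2_ge0 eq_sym andbT; apply: contra_neq u0 => /norm2_eq0.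
- by rewrite lt_neqAle norm2_ge0 eq_sym andbT; apply: contra_neq z0 => /norm2_eq0.
Qed.

Definition sign_mx n p (E : 'M[bool]_(n, p)) : 'M[R]_(n, p) :=
  \matrix_(i, j) (-1) ^+ E i j.

Lemma bias_mean0 n p (F : {ffun 'I_n * 'I_p -> bool} -> R) :
  \sum_s F s = 2 ^+ (n * p) * bias_mean (fun=> 0) F.
Proof.
rewrite mulr_sumr; apply: eq_bigr => s _; rewrite mulrA.
have -> : bias_weight (fun=> 0) s = (2 ^+ (n * p))^-1 :> R.
  rewrite /bias_weight; under eq_bigr do rewrite mul0r addr0 div1r.
  by rewrite prodr_const card_prod !card_ord exprVn.
by rewrite divff ?mul1r// expf_neq0.
Qed.

Lemma sum_sign_mx n p (F : 'M[bool]_(n, p) -> R) :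
  \sum_E F E = \sum_(s : {ffun 'I_n * 'I_p -> bool}) F (\matrix_(i, j) s (i, j)).
Proof.
rewrite (reindex (fun s : {ffun 'I_n * 'I_p -> bool} => \matrix_(i, j) s (i, j)))//.
exists (fun E : 'M[bool]_(n, p) => [ffun ij => E ij.1 ij.2]) => [s _|E _].
  by apply/ffunP => -[i j]; rewrite ffunE mxE.
by apply/matrixP => i j; rewrite !mxE ffunE.
Qed.

(** Both sides vanish if u or z is zero. The division-free form is the one produced by the rank-one
    bound, and its measurability is immediate. *)
Lemma delocalization_termE n p (theta : R) (u : 'cV[R]_n) (z : 'cV[R]_p) :
  delocalization_term theta u z =
  theta * (norm2 u * norm_sup z + norm2 z * norm_sup u) / 2.
Proof.
rewrite /delocalization_term.
have [u0|u0] := eqVneq (norm2 u) 0.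
  rewrite u0 (norm2_eq0 u0) /norm_sup normr0; ring.
have [z0|z0] := eqVneq (norm2 z) 0.
  rewrite z0 (norm2_eq0 z0) /norm_sup normr0; ring.
by field; rewrite z0 u0.
Qed.

(** 18 is twice the 9 of the rank-one bound, because the delocalization term averages its two
    ratios. The factor 2 ^+ (n * p) turns the mean over sign patterns into a sum. *)
Lemma sum_opnorm_signed_signal n p k (theta : 'I_k -> R)
    (u : 'I_k -> 'cV[R]_n) (z : 'I_k -> 'cV[R]_p) :
  (forall i, 0 <= theta i) ->
  \sum_(E : 'M[bool]_(n, p)) opnorm (hadamard (sign_mx E)
     (\sum_(i < k) theta i *: (u i *m (z i)^T))) <=
  2 ^+ (n * p) * (18 * \sum_(i < k) delocalization_term (theta i) (u i) (z i)).
Proof.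
move=> theta0; rewrite sum_sign_mx bias_mean0 ler_pM2l ?exprn_gt0//.
pose M i (s : {ffun 'I_n * 'I_p -> bool}) : 'M[R]_(n, p) :=
  \matrix_(a, b) (sgn (s (a, b)) * (u i a 0 * z i b 0)).
apply: (@le_trans _ _ (bias_mean (fun=> 0)
    (fun s => \sum_(i < k) theta i * opnorm (M i s)))).
  apply: le_bias_mean => [i|s]; first by rewrite normr0.
  have -> : hadamard (sign_mx (\matrix_(i, j) s (i, j)))
     (\sum_(i < k) theta i *: (u i *m (z i)^T)) = \sum_(i < k) theta i *: M i s.
    apply/matrixP => a b; rewrite !mxE !summxE mulr_sumr; apply: eq_bigr => i _.
    by rewrite !mxE big_ord1 !mxE mulrCA.
  rewrite (le_trans (opnorm_sum _ _))//; apply: ler_sum => i _.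
  by rewrite (le_trans (opnormZ_le _ _))// ger0_norm.
rewrite bias_mean_sum mulr_sumr; apply: ler_sum => i _.
rewrite bias_meanZ delocalization_termE.
apply: (le_trans (ler_wpM2l (theta0 i) (mean_opnorm_rank_one (u i) (z i)))).
lra.
Qed.

End SignedSignal.

(** * Sample quantiles as convex combinations of sample values *)

Section SampleQuantileBounds.
Context {R : realType}.

Lemma order_stat_index (T : nat) (j : int) :
  (0 < T)%N -> ((minn `|Num.max j 1|%N T).-1 < T)%N.
Proof.
move=> T0; apply: (@leq_trans (minn `|Num.max j 1|%N T)); last exact: geq_minr.
rewrite prednK// leq_min T0 andbT absz_gt0; apply/eqP => j0.
by have : 1 <= Num.max j 1 by [rewrite le_max lexx orbT|]; rewrite j0.
Qed.

Lemma order_stat_in (T : nat) (x : 'I_T -> R) (j : int) :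
  (0 < T)%N -> exists t, order_stat x j = x t.
Proof.
move=> T0; rewrite /order_stat; set s := sort _ _; set i := _.-1.
have sz : size s = T by rewrite size_sort size_map -cardE card_ord.
have : s`_i \in s by rewrite mem_nth// sz; exact: order_stat_index.
by rewrite mem_sort => /mapP[t _ ->]; exists t.
Qed.

Lemma quantile_weight_itv (a : quantile_type) (y : R) :
  0 <= quantile_weight a (Num.floor y) (y - (Num.floor y)%:~R) <= 1.
Proof.
set j := Num.floor y; have g0 : 0 <= y - j%:~R by rewrite subr_ge0 Num.Theory.floor_le.
have g1 : y - j%:~R <= 1.
  by have := Num.Theory.floorD1_gt y; rewrite intrD lerBlDl => /ltW.
by case: a => //=; try case: ifP => _; lra.
Qed.

Lemma sample_quantile_between (a : quantile_type) (q : R) (T : nat)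
    (x : 'I_T -> R) (lo hi : R) : (0 < T)%N -> (forall t, lo <= x t <= hi) ->
  lo <= sample_quantile a q x <= hi.
Proof.
move=> T0 xb; rewrite /sample_quantile; move: (q * _ + _) => y; cbv zeta.
have /andP[] := quantile_weight_itv a y.
move: (quantile_weight _ _ _) => c c0 c1.
have [t ->] := order_stat_in x (Num.floor y) T0.
have [t' ->] := order_stat_in x (Num.floor y + 1) T0.
have /andP[? ?] := xb t; have /andP[? ?] := xb t'.
by apply/andP; split; nra.
Qed.

End SampleQuantileBounds.

(** * Measurability *)

Section EntrywiseLipschitz.
Context {R : realType}.

(** Lipschitz for the largest entry of the difference. Only the entries of a random matrix are
    assumed measurable, and rational matrices are dense for this distance. *)
Definition entrywise_lipschitz n p (f : 'M[R]_(n, p) -> R) :=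
  exists2 C : R, 0 <= C & forall (X Y : 'M[R]_(n, p)) (e : R), 0 <= e ->
    (forall i j, `|X i j - Y i j| <= e) -> `|f X - f Y| <= C * e.

Lemma opnorm_entrywise_lipschitz n p : entrywise_lipschitz (@opnorm R n p).
Proof.
exists (n%:R * p%:R) => [|X Y e e0 XY]; first by rewrite mulr_ge0.
rewrite (le_trans (opnorm_dist X Y))// opnorm_entries// => i j.
by rewrite !mxE.
Qed.

Lemma singular_value_entrywise_lipschitz n p k :
  entrywise_lipschitz (fun X : 'M[R]_(n, p) => (singular_values X)`_k).
Proof.
exists (n%:R * p%:R) => [|X Y e e0 XY]; first by rewrite mulr_ge0.
rewrite (le_trans (singular_value_lipschitz X Y k))// opnorm_entries// => i j.
by rewrite !mxE.
Qed.

Lemma norm2_entrywise_lipschitz n : entrywise_lipschitz (@norm2 R n).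
Proof.
exists n%:R => // x y e e0 xy; apply: (@le_trans _ _ (norm2 (x - y))).
  have := norm2_triangle (x - y) y; rewrite subrK => h1.
  have := norm2_triangle (y - x) x; rewrite subrK => h2.
  have := norm2Z (-1) (x - y); rewrite scaleN1r opprB normrN1 mul1r => h3.
  by rewrite ler_norml; apply/andP; split; lra.
rewrite (le_trans (norm2_le_sum _))// mulr_natl -[n in leRHS]card_ord -sumr_const.
by apply: ler_sum => i _; rewrite !mxE.
Qed.

Lemma norm_sup_entrywise_lipschitz n : entrywise_lipschitz (@norm_sup R n).
Proof.
exists 1 => // x y e e0 xy; rewrite mul1r (le_trans (ler_dist_dist _ _))//.
rewrite [leLHS]/Num.Def.normr/= mx_normrE; apply: bigmax_le => // -[i j] _ /=.
by rewrite !mxE.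
Qed.

(** The two samples may be sorted by different permutations, so the argument counts: at least i + 1
    of the y_t are at most c, and the x_t with the same t are at most c + e. *)
Lemma order_stat_le_shift T (x y : 'I_T -> R) (j : int) (e : R) : (0 < T)%N ->
  (forall t, x t <= y t + e) -> order_stat x j <= order_stat y j + e.
Proof.
move=> T0 xy; rewrite /order_stat; set i := _.-1.
have iT : (i < T)%N by exact: order_stat_index.
have sorted_sort (f : 'I_T -> R) : sorted <=%R (sort <=%R [seq f t | t : 'I_T]).
  by apply: sort_sorted; exact: le_total.
have sz (f : 'I_T -> R) : size (sort <=%R [seq f t | t : 'I_T]) = T.
  by rewrite size_sort size_map -cardE card_ord.
apply: nth_count_le => //; set c := _`_i.
have : (i < count (<= c) (sort <=%R [seq y t | t : 'I_T]))%N.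
  rewrite ltnNge; apply/negP => ci.
  have := nth_count_gt (x := c) 0 (sorted_sort y) (i := i).
  by rewrite ci sz iT -/c ltxx => /(_ isT).
move=> /leq_trans; apply.
rewrite !(permP (permEl (perm_sort _ _))) !count_map; apply: sub_count => t /= yc.
by rewrite (le_trans (xy t))// lerD2r.
Qed.

(** The index and the weight depend on q, T and the type alone, so both samples use the same convex
    combination of order statistics. *)
Lemma sample_quantile_entrywise_lipschitz (a : quantile_type) (q : R) T :
  (0 < T)%N ->
  entrywise_lipschitz (fun x : 'rV[R]_T => sample_quantile a q (fun t => x 0 t)).
Proof.
move=> T0; exists 1 => // x y e e0 xy; rewrite mul1r.
rewrite /sample_quantile; move: (q * _ + _) => w; cbv zeta.
have /andP[] := quantile_weight_itv a w.
move: (quantile_weight _ _ _) => c c0 c1.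
have le1 t : x 0 t <= y 0 t + e by have := xy 0 t; rewrite ler_norml; lra.
have le2 t : y 0 t <= x 0 t + e by have := xy 0 t; rewrite ler_norml; lra.
have h1 := order_stat_le_shift (Num.floor w) T0 le1.
have h2 := order_stat_le_shift (Num.floor w) T0 le2.
have h3 := order_stat_le_shift (Num.floor w + 1) T0 le1.
have h4 := order_stat_le_shift (Num.floor w + 1) T0 le2.
by rewrite ler_norml; apply/andP; split; nra.
Qed.

End EntrywiseLipschitz.

Section RandomMatrixMeasurability.
Context {d : measure_display} {Omega : measurableType d} {R : realType}.

(** The event f (X w) > a is a countable union, over rational matrices M and radii rad k with a + C
    rad k < f M, of the events that every entry of X w is within rad k of that of M. *)
Lemma measurable_entrywise_lipschitz n p (f : 'M[R]_(n, p) -> R)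
    (X : Omega -> 'M[R]_(n, p)) :
  entrywise_lipschitz f -> random_mx X ->
  measurable_fun [set: Omega] (fun w => f (X w)).
Proof.
move=> [C C0 fC] mX mD; apply: (measurability _ (RGenOInfty.measurableE R)) => //.
move=> /= _ [_ [a ->] <-]; rewrite preimage_itvoy setTI.
pose Mr (M : 'M[rat]_(n, p)) : 'M[R]_(n, p) := map_mx ratr M.
pose rad k : R := k.+1%:R^-1.
rewrite [X in measurable X](_ : _ = \bigcup_(Mk : 'M[rat]_(n, p) * nat)
   [set w | a + C * rad Mk.2 < f (Mr Mk.1) /\
      forall ij : 'I_n * 'I_p, `|X w ij.1 ij.2 - Mr Mk.1 ij.1 ij.2| < rad Mk.2]).
  apply: countable_bigcupT_measurable => [|[M k]/=]; first exact: countableP.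
  have [aM|aM] := ltP (a + C * rad k) (f (Mr M)); last first.
    rewrite [X in measurable X](_ : _ = set0)//; by apply/seteqP; split => // w [].
  rewrite [X in measurable X](_ : _ = \bigcap_(ij in [set: 'I_n * 'I_p])
      (fun w => X w ij.1 ij.2) @^-1` (ball (Mr M ij.1 ij.2) (rad k))).
    apply: fin_bigcap_measurable => [|ij _]; first exact: finite_finset.
    rewrite -[X in measurable X]setTI; apply: mX => //.
    by apply: open_measurable; exact: ball_open.
  apply/seteqP; split => w /=.
    by move=> [_ wM] ij _; rewrite /ball/= distrC.
  by move=> wM; split => // ij; have := wM ij Logic.I; rewrite /ball/= distrC.
apply/seteqP; split => w /=; last first.
  move=> [[M k] _ /= [aM wM]].
  have : `|f (Mr M) - f (X w)| <= C * rad k.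
    apply: fC => [|i j]; first by rewrite invr_ge0.
    by rewrite distrC; exact/ltW/(wM (i, j)).
  by rewrite ler_norml => /andP[_]; lra.
move=> aX.
(* One C rad k pays for replacing X w by M, the other for the margin required of f M. *)
have [k kP] : exists k, 2 * C * rad k < f (X w) - a.
  have fa : 0 < f (X w) - a by rewrite subr_gt0.
  exists (Num.truncn (2 * C / (f (X w) - a))).
  rewrite /rad ltr_pdivrMr// [ltRHS]mulrC -ltr_pdivrMr//; exact: truncnS_gt.
have rk : 0 < rad k by rewrite invr_gt0.
have rat_near (x : R) : exists r : rat, `|x - ratr r| < rad k.
  have /rat_in_itvoo[r /itvP xr] : x < x + rad k by rewrite ltrDl.
  by exists r; rewrite distrC ger0_norm ?subr_ge0 ?xr// ltrBlDl xr.
pose M : 'M[rat]_(n, p) := \matrix_(i, j) sval (cid (rat_near (X w i j))).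
have MP i j : `|X w i j - Mr M i j| < rad k.
  by rewrite !mxE; case: cid.
exists (M, k) => //=; split; last by move=> ij; exact: MP.
have : `|f (X w) - f (Mr M)| <= C * rad k.
  by apply: fC => [|i j]; [exact: ltW|exact/ltW/MP].
by rewrite ler_norml => /andP[_]; lra.
Qed.

Lemma measurable_opnorm n p (X : Omega -> 'M[R]_(n, p)) : random_mx X ->
  measurable_fun [set: Omega] (fun w => opnorm (X w)).
Proof. exact: (measurable_entrywise_lipschitz (opnorm_entrywise_lipschitz n p)). Qed.

Lemma measurable_singular_value n p k (X : Omega -> 'M[R]_(n, p)) : random_mx X ->
  measurable_fun [set: Omega] (fun w => (singular_values (X w))`_k).
Proof. exact: (measurable_entrywise_lipschitz (singular_value_entrywise_lipschitz n p k)). Qed.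

Lemma random_mx_hadamard n p (X Y : Omega -> 'M[R]_(n, p)) :
  random_mx X -> random_mx Y -> random_mx (fun w => hadamard (X w) (Y w)).
Proof.
move=> mX mY i j; under eq_fun do rewrite mxE.
exact: measurable_funM.
Qed.

Lemma random_mxD n p (X Y : Omega -> 'M[R]_(n, p)) :
  random_mx X -> random_mx Y -> random_mx (fun w => X w + Y w).
Proof.
move=> mX mY i j; under eq_fun do rewrite mxE.
exact: measurable_funD.
Qed.

Lemma random_mx_cst n p (A : 'M[R]_(n, p)) : random_mx (fun _ : Omega => A).
Proof. by move=> i j; exact: measurable_cst. Qed.

Lemma measurable_le_set (f g : Omega -> R) :
  measurable_fun [set: Omega] f -> measurable_fun [set: Omega] g ->
  measurable [set w | f w <= g w].
Proof.
move=> mf mg; rewrite [X in measurable X](_ : _ =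
    [set: Omega] `&` (g \- f) @^-1` `[0, +oo[).
  by apply: measurable_funB => //; exact: measurable_itv.
by apply/seteqP; split => w /=; rewrite in_itv/= andbT subr_ge0 => // -[].
Qed.

Lemma measurable_lt_set (f g : Omega -> R) :
  measurable_fun [set: Omega] f -> measurable_fun [set: Omega] g ->
  measurable [set w | f w < g w].
Proof.
move=> mf mg; rewrite [X in measurable X](_ : _ = ~` [set w | g w <= f w]).
  by apply: measurableC; exact: measurable_le_set.
by apply/seteqP; split => w /=; rewrite ltNge => /negP.
Qed.

(* The value of a probability at a non-measurable set is a junk value, so this
   measurability cannot be dispensed with. *)
Lemma measurable_flippa_eq (a : quantile_type) (q tau : R) T n p k
    (X : Omega -> 'M[R]_(n, p)) (Rs : 'I_T -> Omega -> 'M[R]_(n, p)) :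
  (0 < T)%N -> 0 <= tau -> random_mx X -> (forall t, random_mx (Rs t)) ->
  measurable [set w | flippa a q tau (X w) (fun t => Rs t w) = k].
Proof.
move=> T0 tau0 mX mRs.
have mthr : measurable_fun [set: Omega]
    (fun w => flippa_threshold a q tau (X w) (fun t => Rs t w)).
  apply: measurable_funD => //.
  pose Y w : 'rV[R]_T := \row_t opnorm (hadamard (Rs t w) (X w)).
  have -> : (fun w => sample_quantile a q (fun t => opnorm (hadamard (Rs t w) (X w))))
      = (fun w => sample_quantile a q (fun t => Y w 0 t)).
    by apply/funext => w; congr sample_quantile; apply/funext => t; rewrite mxE.
  apply: (measurable_entrywise_lipschitz (sample_quantile_entrywise_lipschitz a q T0)).
  move=> i t; under eq_fun do rewrite mxE.
  by apply: measurable_opnorm; exact: random_mx_hadamard.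
pose stop i := [set w | flippa_stop a q tau (X w) (fun t => Rs t w) i].
have mstop i : measurable (stop i).
  rewrite [X in measurable X](_ : _ = [set w | (singular_values (X w))`_i <=
      flippa_threshold a q tau (X w) (fun t => Rs t w)]).
    by apply: measurable_le_set => //; exact: measurable_singular_value.
  by apply/seteqP; split => w; rewrite /stop/flippa_stop/= lee_fin.
rewrite [X in measurable X](_ : _ = stop k `&` \bigcap_(i in [set i | (i < k)%N]) ~` stop i).
  apply: measurableI => //; apply: fin_bigcap_measurable => [|i _].
    exact: finite_II.
  exact: measurableC.
apply/seteqP; split => w /=.
  have [sk kmin] := flippaP a q (X w) (fun t => Rs t w) tau0.
  move=> kE; rewrite kE in sk kmin; split => // i /= ik /kmin.
  by rewrite leqNgt ik.
move=> [sk ns]; have [sk' kmin] := flippaP a q (X w) (fun t => Rs t w) tau0.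
apply/eqP; rewrite eqn_leq kmin//= leqNgt; apply/negP => /ns; exact.
Qed.

End RandomMatrixMeasurability.

(** * Random signs and symmetric noise *)

Section SignAveraging.
Context {d : measure_display} {Omega : measurableType d} {R : realType}.
Variable P : probability Omega R.
Local Open Scope ereal_scope.

Lemma fsume_finType (I : finType) (F : I -> \bar R) :
  \sum_(i \in [set: I]) F i = \sum_i F i.
Proof.
rewrite [in RHS]fsbig_seq ?index_enum_uniq//.
rewrite (_ : [set: I] = [set` index_enum I])//.
by apply/seteqP; split => i //= _; rewrite mem_index_enum.
Qed.

Lemma probability_union_bound (I : finType) (A : set Omega) (B : I -> set Omega) :
  measurable A -> (forall i, measurable (B i)) -> A `<=` \bigcup_i B i ->
  P A <= \sum_i P (B i).
Proof.
move=> mA mB AB; rewrite -fsume_finType.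
by apply: content_sub_fsum => //; exact: finite_finset.
Qed.

(** [uniform_signs] only prescribes the mass of each sign pattern. These 2^(np) disjoint events
    already have total mass 1. *)
Lemma uniform_signs_ae n p (Q : Omega -> 'M[R]_(n, p)) : random_mx Q ->
  uniform_signs P Q -> P (~` \bigcup_(E : 'M[bool]_(n, p)) [set w | Q w = sign_mx E]) = 0.
Proof.
move=> mQ uQ; have mE (E : 'M[bool]_(n, p)) : measurable [set w | Q w = sign_mx E].
  rewrite [X in measurable X](_ : _ = \bigcap_(ij in [set: 'I_n * 'I_p])
      ([set: Omega] `&` (fun w => Q w ij.1 ij.2) @^-1` [set sign_mx E ij.1 ij.2])).
    by apply: fin_bigcap_measurable => [|ij _]; [exact: finite_finset|exact: mQ].
  apply/seteqP; split => w /= => [QE ij _|QE]; first by split => //=; rewrite QE.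
  by apply/matrixP => i j; have [] := QE (i, j) Logic.I.
rewrite probability_setC; last exact: fin_bigcup_measurable.
rewrite measure_fin_bigcup//; [|exact: finite_finset|]; last first.
  apply/trivIsetP => E F _ _ EF; apply/seteqP; split => // w /= [-> /matrixP QF].
  case/eqP: EF; apply/matrixP => i j; have := QF i j; rewrite !mxE.
  exact: signr_inj.
rewrite fsume_finType (eq_bigr (fun=> ((2 ^+ (n * p))^-1)%:E)); last first.
  by move=> E _; exact: uQ.
rewrite sumEFin sumr_const card_mx card_bool -(mulr_natl (2 ^- (n * p))).
by rewrite natrX mulfV ?subee// expf_neq0.
Qed.

Lemma sign_event_measurable n p (Q : Omega -> 'M[R]_(n, p)) (M : 'M[R]_(n, p)) :
  sigma_of_mx Q [set w | Q w = M].
Proof.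
rewrite /sigma_of_mx; set G := \bigcup_(_ in _) _.
(* With the generated sigma-algebra the sample space is a measurable space in its own right, so
   closure under finite intersections applies to it. *)
pose T : measurableType (sigma_display G) := g_sigma_algebraType G.
rewrite [X in <<s _ >> X](_ : _ = \bigcap_(ij in [set: 'I_n * 'I_p])
    ([set: Omega] `&` (fun w => Q w ij.1 ij.2) @^-1` [set M ij.1 ij.2])).
  apply: (@fin_bigcap_measurable _ T) => [|ij _]; first exact: finite_finset.
  apply: sub_sigma_algebra.
  by exists ij => //; exists [set M ij.1 ij.2].
apply/seteqP; split => w /= => [QE ij _|QE]; first by split => //=; rewrite QE.
by apply/matrixP => i j; have [] := QE (i, j) Logic.I.
Qed.

Lemma sigma_of_mx_measurable n p (Q : Omega -> 'M[R]_(n, p)) (A : set Omega) :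
  random_mx Q -> sigma_of_mx Q A -> measurable A.
Proof.
move=> mQ; apply: smallest_sub; first exact: sigma_algebra_measurable.
by move=> _ [ij _ [B mB <-]]; exact: mQ.
Qed.

(** Conditioning on a discrete variable: up to a null event, A splits along the values E of the sign
    matrix, and on each of them it lies in an event of (S, N), which is independent of that
    value. *)
Lemma sign_average n p T (S N : Omega -> 'M[R]_(n, p))
    (Rs : 'I_T -> Omega -> 'M[R]_(n, p)) (t : 'I_T) (A : set Omega)
    (B : 'M[bool]_(n, p) -> set Omega) :
  random_mx (Rs t) -> uniform_signs P (Rs t) -> independent_signs P S N Rs ->
  measurable A -> (forall E, measurable (B E)) ->
  (forall E, sigma_of_mx (fun w => row_mx (S w) (N w)) (B E)) ->
  (forall E w, Rs t w = sign_mx E -> A w -> B E w) ->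
  P A <= \sum_(E : 'M[bool]_(n, p)) ((2 ^+ (n * p))^-1)%:E * P (B E).
Proof.
move=> mR uR iR mA mB sB AB.
have indep E : P ([set w | Rs t w = sign_mx E] `&` B E) =
    ((2 ^+ (n * p))^-1)%:E * P (B E).
  pose F (o : option 'I_T) :=
    if o is Some _ then [set w | Rs t w = sign_mx E] else B E.
  have FJ o : o \in [set None; Some t]%SET -> (if o is Some t then sigma_of_mx (Rs t)
    else sigma_of_mx (fun w => row_mx (S w) (N w))) (F o).
    by rewrite !inE => /orP[] /eqP ->; [exact: sB|exact: sign_event_measurable].
  have := iR [set None; Some t]%SET F FJ.
  rewrite big_setU1 ?inE//= big_set1 -(uR E) muleC => <-; congr (P _).
  apply/seteqP; split => w /=.
    by move=> [RE BE] o /=; rewrite !inE => /orP[] /eqP ->.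
  by move=> H; split; [apply: (H (Some t))|apply: (H None)]; rewrite /= !inE eqxx ?orbT.
have mE E : measurable [set w | Rs t w = sign_mx E].
  by apply: (sigma_of_mx_measurable mR); exact: sign_event_measurable.
pose C := ~` \bigcup_(E : 'M[bool]_(n, p)) [set w | Rs t w = sign_mx E].
have mC : measurable C by apply: measurableC; exact: fin_bigcup_measurable.
pose D (E : 'M[bool]_(n, p)) := [set w | Rs t w = sign_mx E] `&` B E.
have mD E : measurable (D E) by exact: measurableI.
have mU : measurable (\bigcup_E D E) by apply: fin_bigcup_measurable.
apply: (@le_trans _ _ (P (C `|` \bigcup_E D E))).
  apply: le_measure; rewrite ?inE//; first exact: measurableU.
  move=> w Aw; have [[E _ QE]|nE] := pselect
      ((\bigcup_(E : 'M[bool]_(n, p)) [set w | Rs t w = sign_mx E]) w).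
    by right; exists E => //; split => //; exact: AB.
  by left.
apply: (le_trans (measureU2 _ mC mU)); rewrite [X in X + _]uniform_signs_ae// add0e.
apply: (le_trans (probability_union_bound mU mD _)) => //.
by apply: lee_sum => E _; rewrite indep.
Qed.

End SignAveraging.

(** * Invariance of the noise law under a fixed sign pattern *)

Section SymmetricLaw.
Context {d : measure_display} {Omega : measurableType d} {R : realType}.
Variable P : probability Omega R.
Local Open Scope ereal_scope.

Definition mx_box n p (B : 'I_n * 'I_p -> set R) : set 'M[R]_(n, p) :=
  [set M | forall ij, B ij (M ij.1 ij.2)].

(** Boxes form a pi-system that contains the whole space; the sigma-algebra they generate makes the
    law of a random matrix a measure determined by its values on boxes. *)
Definition mx_boxes n p : set (set 'M[R]_(n, p)) :=
  [set mx_box B | B in [set B | forall ij, measurable (B ij)]].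

Lemma mx_boxes_setI n p : setI_closed (@mx_boxes n p).
Proof.
move=> _ _ [B mB <-] [C mC <-]; exists (fun ij => B ij `&` C ij).
  by move=> ij; exact: measurableI.
apply/seteqP; split => M /=; first by move=> BC; split => ij; have [] := BC ij.
by move=> [BM CM] ij; split; [exact: BM|exact: CM].
Qed.

Lemma mx_boxes_setT n p : mx_boxes (n := n) (p := p) setT.
Proof. by exists (fun=> setT) => //; apply/seteqP; split. Qed.

Lemma mx_entry_measurable n p :
  random_mx (fun M : g_sigma_algebraType (@mx_boxes n p) => M).
Proof.
move=> i j _ B mB; rewrite setTI; apply: sub_sigma_algebra.
exists (fun ij => if ij == (i, j) then B else setT).
  by move=> ij; case: ifP.
apply/seteqP; split => M /= => [/(_ (i, j))|BM ij]; first by rewrite eqxx.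
by case: eqP => // ->.
Qed.

Lemma random_mx_measurable n p (X : Omega -> 'M[R]_(n, p)) : random_mx X ->
  measurable_fun [set: Omega] (X : Omega -> g_sigma_algebraType (@mx_boxes n p)).
Proof.
move=> mX; apply: (@measurability _ _ _ (g_sigma_algebraType (@mx_boxes n p)) _ _
  (@mx_boxes n p) erefl).
move=> _ [_ [B mB <-] <-]; rewrite setTI.
rewrite [X in measurable X](_ : _ = \bigcap_(ij in [set: 'I_n * 'I_p])
    ([set: Omega] `&` (fun w => X w ij.1 ij.2) @^-1` B ij)).
  by apply: fin_bigcap_measurable => [|ij _]; [exact: finite_finset|exact: mX].
by apply/seteqP; split => w /= => [BX ij _|BX ij]; [split => //|have [] := BX ij Logic.I].
Qed.

Lemma eq_law_of_boxes n p (X Y : Omega -> 'M[R]_(n, p)) (f : 'M[R]_(n, p) -> R)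
    (B : set R) :
  random_mx X -> random_mx Y ->
  (forall C, (forall ij, measurable (C ij)) ->
    P (X @^-1` mx_box C) = P (Y @^-1` mx_box C)) ->
  entrywise_lipschitz f -> measurable B ->
  P [set w | B (f (X w))] = P [set w | B (f (Y w))].
Proof.
move=> mX mY XY flip mB; pose M : measurableType _ := g_sigma_algebraType (@mx_boxes n p).
pose X' : {mfun Omega >-> M} := mfun_Sub (mem_set (random_mx_measurable mX)).
pose Y' : {mfun Omega >-> M} := mfun_Sub (mem_set (random_mx_measurable mY)).
have mfB : measurable (f @^-1` B : set M).
  have := measurable_entrywise_lipschitz flip (@mx_entry_measurable n p).
  by move=> /(_ measurableT B mB); rewrite setTI.
suff : distribution P X' (f @^-1` B) = distribution P Y' (f @^-1` B) by [].
apply: (@measure_unique _ R M (@mx_boxes n p) (fun=> setT) erefl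
  (@mx_boxes_setI n p) (fun=> mx_boxes_setT n p) _
  (distribution P X') (distribution P Y')) => //.
- by rewrite bigcup_const.
- by move=> _ [C mC <-]; exact: XY.
- by move=> _; rewrite -ge0_fin_numE// fin_num_measure.
Qed.

Lemma independent_entries_box n p (N : Omega -> 'M[R]_(n, p)) C :
  independent_entries P N -> (forall ij, measurable (C ij)) ->
  P (N @^-1` mx_box C) = \prod_ij P [set w | C ij (N w ij.1 ij.2)].
Proof.
move=> iN mC.
have := iN [set: 'I_n * 'I_p]%SET (fun ij => [set w | C ij (N w ij.1 ij.2)]) => iNC.
transitivity (P (\bigcap_(ij in [set` [set: 'I_n * 'I_p]%SET])
    [set w | C ij (N w ij.1 ij.2)])).
  congr (P _); apply/seteqP; split => w /= => [CN ij _|CN ij]; first exact: CN.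
  by apply: CN; rewrite /= inE.
rewrite iNC => [|ij _]; last by exists (C ij) => //; rewrite setTI.
by apply: eq_bigl => ij; rewrite inE.
Qed.

(** The probability of a box is a product over the entries by independence, and flipping the sign of
    an entry preserves its factor by symmetry. *)
Lemma signed_noise_law n p (N : Omega -> 'M[R]_(n, p)) (E : 'M[bool]_(n, p))
    (f : 'M[R]_(n, p) -> R) (B : set R) :
  random_mx N -> independent_entries P N -> symmetric_entries P N ->
  entrywise_lipschitz f -> measurable B ->
  P [set w | B (f (hadamard (sign_mx E) (N w)))] = P [set w | B (f (N w))].
Proof.
move=> mN iN sN flip mB; apply: (eq_law_of_boxes
  (X := fun w => hadamard (sign_mx E) (N w)) (Y := N) (f := f)) => //.
  by apply: random_mx_hadamard => //; exact: random_mx_cst.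
move=> C mC.
pose C' (ij : 'I_n * 'I_p) := (fun x : R => (-1) ^+ E ij.1 ij.2 * x)%R @^-1` C ij.
have mC' ij : measurable (C' ij).
  rewrite -[X in measurable X]setTI.
  by apply: (measurable_funM (measurable_cst _) (@measurable_id _ _ setT)).
transitivity (P (N @^-1` mx_box C')).
  congr (P _); apply/seteqP; split => w /= CN ij; have := CN ij.
    by rewrite !mxE.
  by rewrite !mxE.
rewrite !independent_entries_box//; apply: eq_bigr => ij _.
rewrite /C'; case: (E ij.1 ij.2) => /=.
  have := sN ij.1 ij.2 (C ij) (mC ij); rewrite /pushforward => ->.
  by congr (P _); apply/seteqP; split => w /=; rewrite expr1 mulN1r.
by congr (P _); apply/seteqP; split => w /=; rewrite expr0 mul1r.
Qed.

End SymmetricLaw.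

(** * Tail bounds for one trial: signed noise and signed signal *)

Section SignedBounds.
Context {d : measure_display} {Omega : measurableType d} {R : realType}.
Variable P : probability Omega R.
Local Open Scope ereal_scope.
Variables (n p T : nat) (S N : Omega -> 'M[R]_(n, p)).
Variables (Rs : 'I_T -> Omega -> 'M[R]_(n, p)) (t : 'I_T).
Hypotheses (mS : random_mx S) (mN : random_mx N) (mR : random_mx (Rs t)).
Hypothesis uR : uniform_signs P (Rs t).
Hypothesis iR : independent_signs P S N Rs.

Let G : set (set Omega) := \bigcup_(ij in [set: 'I_n * 'I_(p + p)])
  preimage_set_system [set: Omega]
    (fun w => (row_mx (S w) (N w)) ij.1 ij.2) measurable.

(** Measurability over this space is membership in the sigma-algebra of (S, N), the one that
    independence refers to; the results on [opnorm] apply to it unchanged. *)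
Let GT : measurableType (sigma_display G) := g_sigma_algebraType G.

Let mGS : random_mx (S : GT -> 'M[R]_(n, p)).
Proof.
move=> i j _ B mB; apply: sub_sigma_algebra; exists (i, lshift p j) => //.
by exists B => //; apply/seteqP; split => w /=; rewrite row_mxEl.
Qed.

Let mGN : random_mx (N : GT -> 'M[R]_(n, p)).
Proof.
move=> i j _ B mB; apply: sub_sigma_algebra; exists (i, rshift p j) => //.
by exists B => //; apply/seteqP; split => w /=; rewrite row_mxEr.
Qed.

Lemma signed_noise_bound (B : set R) :
  independent_entries P N -> symmetric_entries P N -> measurable B ->
  P [set w | B (opnorm (hadamard (Rs t w) (N w)))] <= P [set w | B (opnorm (N w))].
Proof.
move=> iN sN mB.
have mev (X : Omega -> 'M[R]_(n, p)) : random_mx X -> measurable [set w | B (opnorm (X w))].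
  by move=> mX; rewrite -[X in measurable X]setTI; exact: (measurable_opnorm mX).
apply: (@le_trans _ _ (\sum_(E : 'M[bool]_(n, p)) ((2 ^+ (n * p))^-1)%:E *
    P [set w | B (opnorm (hadamard (sign_mx E) (N w)))])).
  apply: (sign_average mR uR iR) => //.
  - by apply: (mev (fun w => hadamard (Rs t w) (N w))); exact: random_mx_hadamard.
  - move=> E; apply: (mev (fun w => hadamard (sign_mx E) (N w))).
    by apply: random_mx_hadamard => //; exact: random_mx_cst.
  - move=> E; have mEN : random_mx (fun w : GT => hadamard (sign_mx E) (N w)).
      by apply: random_mx_hadamard => //; exact: random_mx_cst.
    by have := measurable_opnorm mEN measurableT mB; rewrite setTI.
  - by move=> E w /= ->.
under eq_bigr do rewrite (signed_noise_law _ mN iN sN (opnorm_entrywise_lipschitz n p) mB).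
rewrite -(fineK (fin_num_measure P _ (mev _ mN))) sumEFin sumr_const card_mx card_bool lee_fin.
by rewrite -[leLHS]mulr_natl natrX mulrA mulfV ?mul1r// expf_neq0.
Qed.

(** Markov's inequality is applied for each fixed sign pattern and the average over patterns is
    moved inside the integral. There theta, u and z are frozen at w, so the deterministic bound
    applies even though they are random. *)
Lemma signed_signal_bound (k : nat) (theta : 'I_k -> Omega -> R)
    (u : 'I_k -> Omega -> 'cV[R]_n) (z : 'I_k -> Omega -> 'cV[R]_p) (delta : R) :
  (forall i, measurable_fun [set: Omega] (theta i)) ->
  (forall i, random_mx (u i)) -> (forall i, random_mx (z i)) ->
  (forall i w, 0 <= theta i w)%R ->
  (forall w, S w = \sum_(i < k) theta i w *: (u i w *m (z i w)^T))%R ->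
  (0 < delta)%R ->
  P [set w | (delta <= opnorm (hadamard (Rs t w) (S w)))%R] <=
  (18 / delta)%:E * 'E_P[fun w => (\sum_(i < k)
    delocalization_term (theta i w) (u i w) (z i w))%R].
Proof.
move=> mtheta mu mz theta0 SE delta0.
have mES E : random_mx (fun w => hadamard (sign_mx E) (S w)).
  by apply: random_mx_hadamard => //; exact: random_mx_cst.
have mev (X : Omega -> 'M[R]_(n, p)) : random_mx X ->
    measurable [set w | (delta <= opnorm (X w))%R].
  by move=> mX; apply: measurable_le_set; [exact: measurable_cst|exact: measurable_opnorm].
apply: (@le_trans _ _ (\sum_(E : 'M[bool]_(n, p)) ((2 ^+ (n * p))^-1)%:E *
    P [set w | (delta <= opnorm (hadamard (sign_mx E) (S w)))%R])).
  apply: (sign_average mR uR iR) => //.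
  - by apply: (mev (fun w => hadamard (Rs t w) (S w))); exact: random_mx_hadamard.
  - by move=> E; exact: (mev _ (mES E)).
  - move=> E; have mGES : random_mx (fun w : GT => hadamard (sign_mx E) (S w)).
      by apply: random_mx_hadamard => //; exact: random_mx_cst.
    have := measurable_opnorm mGES.
    by apply: (@measurable_le_set _ GT R (cst delta)); exact: measurable_cst.
  - by move=> E w /= ->.
apply: (@le_trans _ _ (\sum_(E : 'M[bool]_(n, p)) ((2 ^+ (n * p))^-1 / delta)%:E *
    \int[P]_w (opnorm (hadamard (sign_mx E) (S w)))%:E)).
  apply: lee_sum => E _; rewrite EFinM -muleA lee_pmul2l ?lte_fin ?invr_gt0 ?exprn_gt0//.
  rewrite muleC lee_pdivlMr//.
  have := @le_integral_comp_abse _ _ _ P setT measurableT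
    (fun w => (opnorm (hadamard (sign_mx E) (S w)))%:E) delta id.
  rewrite /= setTI muleC => H; apply: (le_trans _ (le_trans (H _ _ _ _ _) _)) => //.
  - rewrite le_eqVlt; apply/orP; left; apply/eqP; congr (_ * _); congr (P _).
    by apply/seteqP; split => w /=; rewrite lee_fin ger0_norm ?opnorm_ge0.
  - by apply/measurable_EFinP; exact: measurable_opnorm.
  - rewrite le_eqVlt; apply/orP; left; apply/eqP; apply: eq_integral => w _ /=.
    by rewrite ger0_norm ?opnorm_ge0.
have iE E : 0 <= \int[P]_w (opnorm (hadamard (sign_mx E) (S w)))%:E.
  by apply: integral_ge0 => w _; rewrite lee_fin opnorm_ge0.
have -> : \sum_(E : 'M[bool]_(n, p)) ((2 ^+ (n * p))^-1 / delta)%:E *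
    \int[P]_w (opnorm (hadamard (sign_mx E) (S w)))%:E =
    ((2 ^+ (n * p))^-1 / delta)%:E *
    \int[P]_w (\sum_(E : 'M[bool]_(n, p)) opnorm (hadamard (sign_mx E) (S w)))%:E.
  rewrite -ge0_sume_distrr//; congr (_ * _).
  rewrite -ge0_integral_sum//; first by apply: eq_integral => w _; rewrite sumEFin.
  - by move=> E; apply/measurable_EFinP; exact: measurable_opnorm.
  - by move=> E w _; rewrite lee_fin opnorm_ge0.
pose Dl w := (\sum_(i < k) delocalization_term (theta i w) (u i w) (z i w))%R.
have mDl : measurable_fun [set: Omega] Dl.
  apply: measurable_sum => i; rewrite [X in measurable_fun _ X](_ : _ = (fun w =>
    theta i w * (norm2 (u i w) * norm_sup (z i w) + norm2 (z i w) * norm_sup (u i w)) / 2)%R);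
    last by apply/funext => w; exact: delocalization_termE.
  have mn2 a (x : Omega -> 'cV[R]_a) : random_mx x -> measurable_fun setT (fun w => norm2 (x w)).
    exact: (measurable_entrywise_lipschitz (norm2_entrywise_lipschitz a)).
  have mns a (x : Omega -> 'cV[R]_a) : random_mx x -> measurable_fun setT (fun w => norm_sup (x w)).
    exact: (measurable_entrywise_lipschitz (norm_sup_entrywise_lipschitz a)).
  apply: measurable_funM; last exact: measurable_cst.
  apply: measurable_funM; first exact: mtheta.
  by apply: measurable_funD; apply: measurable_funM; [exact: mn2|exact: mns|exact: mn2|exact: mns].
have Dl0 w : (0 <= Dl w)%R.
  apply: sumr_ge0 => i _; rewrite delocalization_termE divr_ge0// mulr_ge0//.
  by rewrite addr_ge0// mulr_ge0 ?norm2_ge0// /norm_sup normr_ge0.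
rewrite expectation.unlock.
apply: (@le_trans _ _ (((2 ^+ (n * p))^-1 / delta)%:E *
    \int[P]_w ((2 ^+ (n * p) * 18)%:E * (Dl w)%:E))).
  rewrite lee_pmul2l ?lte_fin ?divr_gt0 ?invr_gt0 ?exprn_gt0//.
  apply: ge0_le_integral => //.
  - by move=> w _; rewrite lee_fin sumr_ge0// => E _; rewrite opnorm_ge0.
  - apply/measurable_EFinP; apply: measurable_sum => E.
    exact: measurable_opnorm.
  - by apply: measurable_funeM; apply/measurable_EFinP.
  - move=> w _; rewrite -EFinM lee_fin -mulrA SE.
    exact: sum_opnorm_signed_signal.
rewrite ge0_integralZl_EFin//; last 2 first.
- by move=> w _; rewrite lee_fin.
- exact/measurable_EFinP.
rewrite muleA -EFinM le_eqVlt; apply/orP; left; apply/eqP; congr (_%:E * _).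
by field; rewrite gt_eqF//= expf_neq0.
Qed.

End SignedBounds.

(** * Consistency *)

Section FlippaSelection.
Context {R : realType}.

Lemma flippa_eq (a : quantile_type) (q tau : R) T n p k (X : 'M[R]_(n, p))
    (Rs : 'I_T -> 'M[R]_(n, p)) : 0 <= tau ->
  (singular_values X)`_k <= flippa_threshold a q tau X Rs ->
  ((flippa_threshold a q tau X Rs)%:E < sigma X k)%E ->
  flippa a q tau X Rs = k.
Proof.
move=> tau0 le_thr lt_thr; have [stop_k kmin] := flippaP a q X Rs tau0.
have thr0 : 0 <= flippa_threshold a q tau X Rs.
  by rewrite addr_ge0// sample_quantile_ge0// => t; exact: opnorm_ge0.
apply/eqP; rewrite eqn_leq kmin ?andTb; last by rewrite /flippa_stop/= lee_fin.
rewrite leqNgt; apply/negP; case: k => [//|k] in lt_thr le_thr *.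
rewrite ltnS => fk; move: stop_k; rewrite /flippa_stop/= lee_fin leNgt => /negP; apply.
have [s_sorted _ _] := singular_valuesP X.
(* Since the list is decreasing, a value above the threshold at one index forces one at every
   smaller index. Passing through counts requires the threshold to be nonnegative. *)
by rewrite sorted_gt_nth// (leq_ltn_trans fk)// -sorted_gt_nth.
Qed.

(** The quantile is within 2 delta of sigmabar and |N| within delta, hence the margins of 3 delta:
    the threshold is at least sigmabar - 2 delta + tau >= sigmabar + delta >= |N|, and at most
    sigmabar + 2 delta + tau <= sigmabar - delta + eps <= |N| + eps. *)
Lemma flippa_eq_of_bounds (a : quantile_type) (q tau sigmabar eps delta : R) T n p k
    (S N X : 'M[R]_(n, p)) (Rs : 'I_T -> 'M[R]_(n, p)) (theta : 'I_k -> R)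
    (u : 'I_k -> 'cV[R]_n) (z : 'I_k -> 'cV[R]_p) :
  (0 < T)%N -> 0 <= tau -> 3 * delta <= tau -> 3 * delta <= eps - tau ->
  S = \sum_(i < k) theta i *: (u i *m (z i)^T) -> X = S + N ->
  ((opnorm N + eps)%:E < sigma X k)%E -> `|opnorm N - sigmabar| <= delta ->
  (forall t, `|opnorm (hadamard (Rs t) N) - sigmabar| <= delta) ->
  (forall t, opnorm (hadamard (Rs t) S) <= delta) ->
  flippa a q tau X Rs = k.
Proof.
move=> T0 tau0 dtau deps SE XE gap.
rewrite ler_norml => /andP[N1 N2] RN RS.
have Rt t : sigmabar - 2 * delta <= opnorm (hadamard (Rs t) X) <= sigmabar + 2 * delta.
  have -> : hadamard (Rs t) X = hadamard (Rs t) S + hadamard (Rs t) N.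
    by apply/matrixP => i j; rewrite XE !mxE mulrDr.
  have := opnorm_dist (hadamard (Rs t) S + hadamard (Rs t) N) (hadamard (Rs t) N).
  rewrite addrK ler_norml => /andP[h1 h2].
  have := RN t; rewrite ler_norml => /andP[h3 h4]; have h5 := RS t.
  by apply/andP; split; lra.
have /andP[Q1 Q2] := sample_quantile_between a q T0 Rt.
apply: flippa_eq => //.
  have XSN : X = \sum_(i < k) theta i *: (u i *m (z i)^T) + N by rewrite XE SE.
  apply: (le_trans (singular_value_low_rank XSN)).
  by rewrite /flippa_threshold; lra.
by apply: le_lt_trans gap; rewrite lee_fin /flippa_threshold; lra.
Qed.

End FlippaSelection.

Section FlippaError.
Context {d : measure_display} {Omega : measurableType d} {R : realType}.
Variable P : probability Omega R.

Lemma measurable_gap n p k (N X : Omega -> 'M[R]_(n, p)) (eps : R) :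
  random_mx N -> random_mx X ->
  measurable [set w | ((opnorm (N w) + eps)%:E < sigma (X w) k)%E].
Proof.
move=> mN mX; case: k => [|k].
  rewrite [X in measurable X](_ : _ = setT)//.
  by apply/seteqP; split => w //= _; rewrite ltry.
have -> : [set w | ((opnorm (N w) + eps)%:E < sigma (X w) k.+1)%E] =
    [set w | opnorm (N w) + eps < (singular_values (X w))`_k].
  by apply/seteqP; split => w; rewrite /= lte_fin.
apply: measurable_lt_set; last exact: measurable_singular_value.
by apply: measurable_funD; [exact: measurable_opnorm|exact: measurable_cst].
Qed.

Lemma random_mx_signal n p k (theta : 'I_k -> Omega -> R)
    (u : 'I_k -> Omega -> 'cV[R]_n) (z : 'I_k -> Omega -> 'cV[R]_p) :
  (forall i, measurable_fun [set: Omega] (theta i)) ->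
  (forall i, random_mx (u i)) -> (forall i, random_mx (z i)) ->
  random_mx (fun w => \sum_(i < k) theta i w *: (u i w *m (z i w)^T)).
Proof.
move=> mtheta mu mz a b.
rewrite [X in measurable_fun _ X](_ : _ =
    (fun w => \sum_(i < k) theta i w * (u i w a 0 * z i w b 0))); last first.
  apply/funext => w; rewrite summxE; apply: eq_bigr => i _.
  by rewrite !mxE big_ord1 !mxE.
apply: measurable_sum => i; apply: measurable_funM; first exact: mtheta.
by apply: measurable_funM; [exact: mu|exact: mz].
Qed.

Lemma flippa_error_bound (a : quantile_type) (q tau sigmabar eps delta : R) T n p k
    (S N X : Omega -> 'M[R]_(n, p)) (Rs : 'I_T -> Omega -> 'M[R]_(n, p))
    (theta : 'I_k -> Omega -> R)
    (u : 'I_k -> Omega -> 'cV[R]_n) (z : 'I_k -> Omega -> 'cV[R]_p) :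
  (0 < T)%N -> 0 <= tau -> 0 < delta -> 3 * delta <= tau -> 3 * delta <= eps - tau ->
  (forall i, measurable_fun [set: Omega] (theta i)) ->
  (forall i, random_mx (u i)) -> (forall i, random_mx (z i)) ->
  random_mx N -> (forall t, random_mx (Rs t)) ->
  (forall i w, 0 <= theta i w) ->
  (forall w, S w = \sum_(i < k) theta i w *: (u i w *m (z i w)^T)) ->
  (forall w, X w = S w + N w) ->
  independent_entries P N -> symmetric_entries P N ->
  (forall t, uniform_signs P (Rs t)) -> independent_signs P S N Rs ->
  (P (~` [set w | flippa a q tau (X w) (fun t => Rs t w) = k]) <=
   P (~` [set w | (opnorm (N w) + eps)%:E < sigma (X w) k]) +
   P [set w | (delta < `|opnorm (N w) - sigmabar|)%R] +
   \sum_(t < T) (P [set w | (delta < `|opnorm (N w) - sigmabar|)%R] +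
     (18 / delta)%:E * 'E_P[fun w => (\sum_(i < k)
        delocalization_term (theta i w) (u i w) (z i w))%R]))%E.
Proof.
move=> T0 tau0 delta0 dtau deps mtheta mu mz mN mR theta0 SE XE iN sN uR iR.
have mS : random_mx S by rewrite (funext SE); exact: random_mx_signal.
have mX : random_mx X by rewrite (funext XE); exact: random_mxD.
pose far : set R := [set y | delta < `|y - sigmabar|].
have mfar : measurable far.
  rewrite -[X in measurable X]setTI.
  have := @measurable_lt_set _ _ R (cst delta) (fun y : R => `|y - sigmabar|).
  rewrite setTI; apply; first exact: measurable_cst.
  apply: measurableT_comp => //; apply: measurable_funB => //.
pose B0 := ~` [set w | ((opnorm (N w) + eps)%:E < sigma (X w) k)%E].
have mB0 : measurable B0 by apply: measurableC; exact: measurable_gap.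
have mev (Y : Omega -> 'M[R]_(n, p)) : random_mx Y ->
    measurable [set w | far (opnorm (Y w))].
  by move=> mY; rewrite -[X in measurable X]setTI; exact: (measurable_opnorm mY).
pose B2 t := [set w | far (opnorm (hadamard (Rs t w) (N w)))].
pose B3 t := [set w | delta <= opnorm (hadamard (Rs t w) (S w))].
have mB2 t : measurable (B2 t).
  by apply: (mev (fun w => hadamard (Rs t w) (N w))); exact: random_mx_hadamard.
have mB3 t : measurable (B3 t).
  apply: measurable_le_set; first exact: measurable_cst.
  by apply: measurable_opnorm; exact: random_mx_hadamard.
have mB23 t : measurable (B2 t `|` B3 t) by exact: measurableU.
have mU : measurable (\bigcup_t (B2 t `|` B3 t)).
  by apply: fin_bigcup_measurable => [|t _]; first exact: finite_finset.
have mB01 : measurable (B0 `|` [set w | far (opnorm (N w))]).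
  by apply: measurableU => //; exact: mev.
have mflippa := measurable_flippa_eq a q k T0 tau0 mX mR.
apply: (@le_trans _ _ (P ((B0 `|` [set w | far (opnorm (N w))]) `|`
    \bigcup_t (B2 t `|` B3 t)))).
  apply: le_measure; rewrite ?inE; [exact: measurableC|exact: measurableU|].
  move=> w /=; apply: contra_notP => good.
  apply: (flippa_eq_of_bounds a q (sigmabar := sigmabar) T0 tau0 dtau deps (SE w) (XE w)) => //.
  - by apply: contra_notT good => gap; left; left; exact/negP.
  - by rewrite leNgt; apply: contra_notN good => h; left; right.
  - by move=> t; rewrite leNgt; apply: contra_notN good => h; right; exists t => //; left.
  - move=> t; rewrite leNgt; apply: contra_notN good => /ltW h.
    by right; exists t => //; right.
apply: (le_trans (measureU2 _ mB01 mU)); apply: leeD.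
  by apply: (le_trans (measureU2 _ mB0 (mev _ mN))).
apply: (le_trans (probability_union_bound P mU mB23 (@subset_refl _ _))).
apply: lee_sum => t _; apply: (le_trans (measureU2 _ (mB2 t) (mB3 t))).
apply: leeD.
  exact: (signed_noise_bound mN (mR t) (uR t) iR iN sN mfar).
exact: (signed_signal_bound mS (mR t) (uR t) iR mtheta mu mz theta0 SE delta0).
Qed.

End FlippaError.

Theorem theorem3p5 (R : realType)
    (n p k : nat -> nat)
    (n_infty : n m @[m --> \oo] --> \oo) (p_infty : p m @[m --> \oo] --> \oo)
    (d : nat -> measure_display) (Omega : forall m, measurableType (d m))
    (P : forall m, probability (Omega m) R)
    (theta : forall m, 'I_(k m) -> Omega m -> R)
    (u : forall m, 'I_(k m) -> Omega m -> 'cV[R]_(n m))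
    (z : forall m, 'I_(k m) -> Omega m -> 'cV[R]_(p m))
    (S N X : forall m, Omega m -> 'M[R]_(n m, p m))
    (T : nat) (Rs : forall m, 'I_T -> Omega m -> 'M[R]_(n m, p m))
    (a : quantile_type) (q tau sigmabar eps : R)
    (theta_meas : forall m i, measurable_fun [set: Omega m] (theta m i))
    (u_meas : forall m i, random_mx (u m i))
    (z_meas : forall m i, random_mx (z m i))
    (N_meas : forall m, random_mx (N m))
    (Rs_meas : forall m t, random_mx (Rs m t))
    (theta_ge0 : forall m i w, 0 <= theta m i w)
    (S_def : forall m w,
       S m w = \sum_(i < k m) theta m i w *: (u m i w *m (z m i w)^T))
    (X_def : forall m w, X m w = S m w + N m w)
    (N_indep : forall m, independent_entries (P m) (N m))
    (N_sym : forall m, symmetric_entries (P m) (N m))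
    (N_norm : cvg_in_probability P (fun m w => opnorm (N m w)) sigmabar)
    (eps_gt0 : 0 < eps)
    (signal_gap :
       (P m [set w | ((opnorm (N m w) + eps)%:E < sigma (X m w) (k m))%E]
          @[m --> \oo] --> 1)%E)
    (q_ge0 : 0 <= q) (q_le1 : q <= 1) (T_ge1 : (1 <= T)%N)
    (tau_gt0 : 0 < tau) (tau_lt_eps : tau < eps)
    (Rs_unif : forall m t, uniform_signs (P m) (Rs m t))
    (Rs_indep : forall m, independent_signs (P m) (S m) (N m) (Rs m))
    (deloc :
       ('E_(P m)[fun w => (\sum_(i < k m)
                   delocalization_term (theta m i w) (u m i w) (z m i w))%R]
          @[m --> \oo] --> 0)%E) :
  (P m [set w | flippa a q tau (X m w) (fun t => Rs m t w) = k m]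
     @[m --> \oo] --> 1)%E.
Proof.
(* The strict inequalities 0 < tau < eps enter here: they leave a positive margin on both sides of
   the threshold. *)
pose delta := Num.min tau (eps - tau) / 3.
have delta0 : 0 < delta by rewrite divr_gt0// lt_min tau_gt0 subr_gt0.
have dE : 3 * delta = Num.min tau (eps - tau) by rewrite /delta mulrC divfK.
have dtau : 3 * delta <= tau by rewrite dE ge_min lexx.
have deps : 3 * delta <= eps - tau by rewrite dE ge_min lexx orbT.
pose good m := [set w | ((opnorm (N m w) + eps)%:E < sigma (X m w) (k m))%E].
pose far m := P m [set w | (delta < `|opnorm (N m w) - sigmabar|)%R].
pose sig m := ((18 / delta)%:E * 'E_(P m)[fun w => (\sum_(i < k m)
  delocalization_term (theta m i w) (u m i w) (z m i w))%R])%E.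
pose err m := (P m (~` good m) + far m + \sum_(t < T) (far m + sig m))%E.
have mS m : random_mx (S m) by rewrite (funext (S_def m)); exact: random_mx_signal.
have mX m : random_mx (X m) by rewrite (funext (X_def m)); exact: random_mxD.
have mgood m : measurable (good m) by exact: measurable_gap.
pose sel m := [set w | flippa a q tau (X m w) (fun t => Rs m t w) = k m].
have msel m : measurable (sel m).
  by apply: measurable_flippa_eq => //; exact: ltW.
have sel_err m : (P m (~` sel m) <= err m)%E.
  exact: (flippa_error_bound a q sigmabar T_ge1 (ltW tau_gt0) delta0 dtau deps
    (theta_meas m) (u_meas m) (z_meas m) (N_meas m) (Rs_meas m) (theta_ge0 m)
    (S_def m) (X_def m) (N_indep m) (N_sym m) (Rs_unif m) (Rs_indep m)).
have deloc_ge0 m w i : 0 <= delocalization_term (theta m i w) (u m i w) (z m i w).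
  rewrite delocalization_termE divr_ge0// mulr_ge0// addr_ge0//.
    by rewrite mulr_ge0 ?norm2_ge0// /norm_sup normr_ge0.
  by rewrite mulr_ge0 ?norm2_ge0// /norm_sup normr_ge0.
have far0 : (far m @[m --> \oo] --> 0)%E := N_norm delta delta0.
have sig0 : (sig m @[m --> \oo] --> 0)%E.
  by rewrite -[X in _ --> X](mule0 (18 / delta)%:E); apply: cvgeZl.
have err0 : (err m @[m --> \oo] --> 0)%E.
  have -> : 0%E = (0 + 0 + \sum_(t < T) 0)%E :> \bar R by rewrite big1// !adde0.
  apply: cvgeD; first by rewrite big1// adde_defC.
    apply: cvgeD => //.
    have -> : (fun m => P m (~` good m)) = (fun m => 1 - P m (good m))%E.
      by apply/funext => m; rewrite probability_setC.
    rewrite -[X in _ --> X](@subee _ 1%E)//; apply: cvgeB => //.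
    exact: cvg_cst.
  (* T does not depend on m, so this is a sum of a fixed number of vanishing terms. *)
  apply: cvg_nnesum => [t _|t _].
    apply: nearW => m; apply: adde_ge0 => //; apply: mule_ge0.
      by rewrite lee_fin divr_ge0// ltW.
    by apply: expectation_ge0 => w; exact: sumr_ge0.
  by rewrite -[X in _ --> X](adde0 0%E); apply: cvgeD.
apply: (@squeeze_cvge _ _ _ _ (fun m => 1 - err m)%E _ (cst 1%E)).
- apply: nearW => m; apply/andP; split; last exact: probability_le1 (msel m).
  have := probability_setC (P m) (measurableC (msel m)); rewrite setCK => selE.
  by rewrite [leRHS]selE leeB.
- rewrite -[X in _ --> X](sube0 1%E); apply: cvgeB => //; exact: cvg_cst.
- exact: cvg_cst.
Qed.
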